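(* Let $p$ be an odd prime, let $k$ be the field with $p$ elements, let $G$ be a finite $p$-group, and let $H$ be a group such that $kG\cong kH$. Assume that $G$ is $2$-generated and that $\gamma_3(G)$ is central in $G$ and of exponent $p$. Then $H$ has the same nilpotency class as $G$ and, for each integer $i\geq2$, one has $\gamma_i(G)\cong\gamma_i(H)$.
   Context: $\gamma_i(G)$ denotes the $i$-th term of the lower central series of $G$, with $\gamma_1(G)=G$. $kG$ denotes the group algebra of $G$ over $k$. *)

(* Defs.v *)
From HB Require Import structures.
From mathcomp Require Import all_boot all_order all_algebra.
From mathcomp Require Import all_fingroup all_solvable.
From mathcomp Require Import finmap.
From mathcomp.multinomials Require Import monalg.

Set Implicit Arguments.
Unset Strict Implicit.
Unset Printing Implicit Defensive.

Import GRing.Theory.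
Local Open Scope fset_scope.
Local Open Scope ring_scope.

(* The group algebra of a possibly infinite group, on the free module
   [malg G R] of finitely supported functions G -> R.  The product of monalg.v
   is not available here: a [monomType] has no nontrivial units. *)
Definition group_algebra (R : nzRingType) (G : groupType) : Type := malg G R.

Section GroupAlgebra.
Context (R : nzRingType) (G : groupType).

HB.instance Definition _ := GRing.Lmodule.on (group_algebra R G).

Implicit Types (g : group_algebra R G) (k : G) (c : R).

Definition ga_elt c k : group_algebra R G := mkmalgU k c.

Definition ga_mul g1 g2 : group_algebra R G :=
  \sum_(k1 <- msupp g1) \sum_(k2 <- msupp g2)
    ga_elt (mcoeff k1 g1 * mcoeff k2 g2) (k1 * k2)%g.

Lemma ga_elt0 k : ga_elt 0 k = 0. Proof. exact: monalgU0. Qed.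

Lemma ga_eltD k c1 c2 : ga_elt (c1 + c2) k = ga_elt c1 k + ga_elt c2 k.
Proof. exact: monalgUD. Qed.

Lemma ga_mulw (d1 d2 : {fset G}) g1 g2 :
  msupp g1 `<=` d1 -> msupp g2 `<=` d2 ->
  ga_mul g1 g2 = \sum_(k1 <- d1) \sum_(k2 <- d2)
    ga_elt (mcoeff k1 g1 * mcoeff k2 g2) (k1 * k2)%g.
Proof.
move=> le_d1 le_d2; rewrite /ga_mul (big_fset_incl _ le_d1) /=.
  apply/eq_bigr=> k1 _; apply/big_fset_incl => // k _ /mcoeff_outdom ->.
  by rewrite mulr0 ga_elt0.
move=> k _ /mcoeff_outdom g1k.
by rewrite big1 // => k' _; rewrite g1k mul0r ga_elt0.
Qed.

Lemma ga_mul0g : left_zero 0 ga_mul.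
Proof. by move=> g; rewrite /ga_mul msupp0 big_seq_fset0. Qed.

Lemma ga_mulg0 : right_zero 0 ga_mul.
Proof.
by move=> g; rewrite /ga_mul msupp0 big1 // => k _; rewrite big_seq_fset0.
Qed.

Lemma ga_mulUg c k g :
  ga_mul (ga_elt c k) g = \sum_(k' <- msupp g) ga_elt (c * mcoeff k' g) (k * k')%g.
Proof.
rewrite (ga_mulw msuppU_le (fsubset_refl _)) big_seq_fset1.
by apply/eq_bigr => k' _; rewrite mcoeffUU.
Qed.

Lemma ga_mulgU c k g :
  ga_mul g (ga_elt c k) = \sum_(k' <- msupp g) ga_elt (mcoeff k' g * c) (k' * k)%g.
Proof.
rewrite (ga_mulw (fsubset_refl _) msuppU_le); apply/eq_bigr => k' _.
by rewrite big_seq_fset1 mcoeffUU.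
Qed.

Lemma ga_mulUU c1 c2 k1 k2 :
  ga_mul (ga_elt c1 k1) (ga_elt c2 k2) = ga_elt (c1 * c2) (k1 * k2)%g.
Proof. by rewrite (ga_mulw msuppU_le msuppU_le) !big_seq_fset1 !mcoeffUU. Qed.

Lemma ga_mulE1l g1 g2 :
  ga_mul g1 g2 = \sum_(k1 <- msupp g1) ga_mul (ga_elt (mcoeff k1 g1) k1) g2.
Proof. by apply/eq_bigr=> k _; rewrite ga_mulUg. Qed.

Lemma ga_mulE1r g1 g2 :
  ga_mul g1 g2 = \sum_(k2 <- msupp g2) ga_mul g1 (ga_elt (mcoeff k2 g2) k2).
Proof.
by rewrite {1}/ga_mul exchange_big; apply/eq_bigr=> k _; rewrite ga_mulgU.
Qed.

Lemma ga_mul1g : left_id (ga_elt 1 1%g) ga_mul.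
Proof.
move=> g; rewrite ga_mulUg [RHS]monalgE.
by apply/eq_bigr=> k _; rewrite mul1r mul1g.
Qed.

Lemma ga_mulg1 : right_id (ga_elt 1 1%g) ga_mul.
Proof.
move=> g; rewrite ga_mulgU [RHS]monalgE.
by apply/eq_bigr=> k _; rewrite mulr1 mulg1.
Qed.

Lemma ga_mulDl : left_distributive ga_mul +%R.
Proof.
move=> g1 g2 g; rewrite (ga_mulw (msuppD_le _ _) (fsubset_refl _)).
rewrite (ga_mulw (fsubsetUl _ (msupp g2)) (fsubset_refl _)).
rewrite (ga_mulw (fsubsetUr (msupp g1) _) (fsubset_refl _)).
rewrite -big_split /=; apply/eq_bigr=> k1 _.
rewrite -big_split /=; apply/eq_bigr=> k2 _.
by rewrite mcoeffD mulrDl ga_eltD.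
Qed.

Lemma ga_mulDr : right_distributive ga_mul +%R.
Proof.
move=> g g1 g2; rewrite (ga_mulw (fsubset_refl _) (msuppD_le _ _)).
rewrite (ga_mulw (fsubset_refl _) (fsubsetUl _ (msupp g2))).
rewrite (ga_mulw (fsubset_refl _) (fsubsetUr (msupp g1) _)).
rewrite -big_split /=; apply/eq_bigr=> k1 _.
rewrite -big_split /=; apply/eq_bigr=> k2 _.
by rewrite mcoeffD mulrDr ga_eltD.
Qed.

Lemma ga_mulA : associative ga_mul.
Proof.
move=> g1 g2 g3.
rewrite [RHS](big_morph (ga_mul^~ _) (fun _ _ => ga_mulDl _ _ _) (ga_mul0g _)).
rewrite ga_mulE1l; apply/eq_bigr=> k1 _.
rewrite [LHS](big_morph (ga_mul _) (fun _ _ => ga_mulDr _ _ _) (ga_mulg0 _)).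
rewrite [RHS](big_morph (ga_mul^~ _) (fun _ _ => ga_mulDl _ _ _) (ga_mul0g _)).
apply/eq_bigr=> k2 _.
rewrite [LHS](big_morph (ga_mul _) (fun _ _ => ga_mulDr _ _ _) (ga_mulg0 _)).
by rewrite ga_mulE1r; apply/eq_bigr=> k3 _; rewrite !ga_mulUU mulrA mulgA.
Qed.

Lemma ga_oner_neq0 : ga_elt 1 1%g != 0.
Proof. by rewrite monalgU_eq0 oner_eq0. Qed.

HB.instance Definition _ := GRing.Zmodule_isNzRing.Build (group_algebra R G)
  ga_mulA ga_mul1g ga_mulg1 ga_mulDl ga_mulDr ga_oner_neq0.

Lemma ga_scaleU c g : c *: g = ga_elt c 1%g * g.
Proof.
rewrite [RHS]ga_mulUg; apply/malgP=> k; rewrite mcoeffZ {1}[g]monalgE.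
rewrite !raddf_sum mulr_sumr; apply/eq_bigr => /= k' _.
by rewrite /ga_elt !mcoeffU mul1g mulrnAr.
Qed.

Lemma ga_scaleAl c g1 g2 : c *: (g1 * g2) = (c *: g1) * g2.
Proof. by rewrite !ga_scaleU mulrA. Qed.

HB.instance Definition _ :=
  GRing.Lmodule_isLalgebra.Build R (group_algebra R G) ga_scaleAl.

End GroupAlgebra.

Section GroupAlgebraCom.
Context (R : comNzRingType) (G : groupType).

Lemma ga_eltC c (g : group_algebra R G) : ga_elt c 1%g * g = g * ga_elt c 1%g.
Proof.
rewrite [LHS]ga_mulUg [RHS]ga_mulgU; apply/eq_bigr => k _.
by rewrite mul1g mulg1 mulrC.
Qed.

Lemma ga_scaleAr c (g1 g2 : group_algebra R G) : c *: (g1 * g2) = g1 * (c *: g2).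
Proof. by rewrite !ga_scaleU mulrA ga_eltC -mulrA. Qed.

HB.instance Definition _ :=
  GRing.Lalgebra_isAlgebra.Build R (group_algebra R G) ga_scaleAr.

End GroupAlgebraCom.

Definition isomorphic_algebras (R : nzRingType) (A B : lalgType R) : Prop :=
  exists f : {lrmorphism A -> B}, bijective f.

Inductive subgroup_gen (G : groupType) (A : G -> Prop) : G -> Prop :=
| subgroup_gen_in x of A x : subgroup_gen A x
| subgroup_gen1 : subgroup_gen A 1%g
| subgroup_genM x y of subgroup_gen A x & subgroup_gen A y :
    subgroup_gen A (x * y)%g
| subgroup_genV x of subgroup_gen A x : subgroup_gen A x^-1%g.

(* Indexed as 'L_n(G): terms 0 and 1 are both the whole group.  For finite G the
   two series agree, see [lower_centralP]. *)
Definition lower_central (G : groupType) (n : nat) : G -> Prop :=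
  iter n.-1
    (fun B => subgroup_gen (fun z => exists x y, B x /\ z = [~ x, y]%g))
    (fun _ => True).
Arguments lower_central : clear implicits.

Definition has_nilpotency_class (G : groupType) (c : nat) : Prop :=
  (forall x, lower_central G c.+1 x -> x = 1%g) /\
  (forall d, (forall x, lower_central G d.+1 x -> x = 1%g) -> (c <= d)%N).

Definition isomorphic_subgroups (G H : groupType)
    (A : G -> Prop) (B : H -> Prop) : Prop :=
  exists f : G -> H,
    [/\ forall x, A x -> B (f x),
        forall x y, A x -> A y -> f (x * y)%g = (f x * f y)%g,
        forall x y, A x -> A y -> f x = f y -> x = y
      & forall z, B z -> exists2 x, A x & f x = z].

Lemma subgroup_genP (G : finGroupType) (P : G -> Prop) (A : {set G}) :
  (forall x, P x <-> x \in A) ->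
  forall x, subgroup_gen P x <-> x \in <<A>>%g.
Proof.
move=> PA x; split.
  elim=> [y /PA Ay||y z _ Ay _ Az|y _ Ay]; first exact: mem_gen.
  - exact: group1.
  - exact: groupM.
  - exact: groupVr.
case/gen_prodgP=> n [c cA ->]; elim/big_ind: _ => [|y z|i _].
- exact: subgroup_gen1.
- exact: subgroup_genM.
- by apply/subgroup_gen_in/PA/cA.
Qed.

Lemma lower_centralP (G : finGroupType) n (x : G) :
  lower_central G n x <-> x \in 'L_n([set: G])%g.
Proof.
case: n => [|n]; first by rewrite lcn0 inE.
elim: n x => [|n IHn] x; first by rewrite lcn1 inE.
rewrite lcnSn; apply: subgroup_genP => z; split.
  by case=> u [v [/IHn Lu ->]]; apply: imset2_f; rewrite ?inE.
by case/imset2P=> u v Lu _ ->; exists u, v; split=> //; apply/IHn.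
Qed.

Lemma has_nilpotency_classP (G : finGroupType) c :
  nilpotent [set: G] ->
  has_nilpotency_class G c <-> nil_class [set: G] = c.
Proof.
move=> nilG.
have trivP d : (forall x, lower_central G d.+1 x -> x = 1%g) <->
    (nil_class [set: G] <= d)%N.
  split=> [triv1 | /(lcn_nil_classP _ nilG) L1 x /lower_centralP].
    apply/(lcn_nil_classP _ nilG)/trivgP/subsetP=> x /lower_centralP/triv1 ->.
    exact: group1.
  by rewrite L1 => /set1P.
split=> [[/trivP le_c min_c] | <-].
  by apply/eqP; rewrite eqn_leq le_c; apply/min_c/trivP.
by split=> [|d /trivP//]; apply/trivP.
Qed.

Lemma isomorphic_subgroupsP (G H : finGroupType)
    (A : {group G}) (B : {group H}) :
  isomorphic_subgroups (fun x => x \in A) (fun x => x \in B) <-> A \isog B.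
Proof.
split=> [[f [fAB fM f_inj f_surj]] | /isogP[f /injmP f_inj fA]].
  have fMA : {in A &, {morph f : x y / (x * y)%g}} by move=> x y; apply: fM.
  apply/isogP; exists (Morphism fMA); first by apply/injmP=> x y; apply: f_inj.
  apply/setP=> z; apply/imsetP/idP => [[x]|Bz].
    by rewrite setIid => /fAB + ->.
  by have [x Ax <-] := f_surj z Bz; exists x; rewrite ?setIid.
exists f; split=> [x Ax|x y|x y|z].
- by rewrite -fA mem_morphim.
- exact: morphM.
- exact: f_inj.
- by rewrite -fA => /morphimP[x Ax _ ->]; exists x.
Qed.

(* Main.v *)
(* Let A = F_pG, N = G', z = [x, y] for generators x, y of G.  For p-groups over
   F_p every isomorphism of group algebras respects augmentations.  The ideal J
   generated by [A, A] is spanned by the (n - 1)g with n in N, whence |G|, |G/N|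
   are determined; so are |Z(G)| and |Z(G) : Z(G) n N| (from
   Z(A)/(Z(A) n [A, A]) = F_pZ(G)) and |M : Phi(M)| for M = G, N (from J/JI for
   the augmentation ideal I).  In our group Z(G) n N has index p in N, and this
   property alone forces gamma_3(H) to be central of exponent p and nontrivial;
   then N = <z> gamma_3 is abelian with Phi(N) = <z^p>, so the order pq of z is
   determined.  All that is left is |gamma_3|, that is, whether z^q lies in
   gamma_3.  With L = [J, A]A and K_i the ideal generated by J^(i+1) and the
   products of i factors J one of which is replaced by L, this happens exactly
   when J^q is contained in [A, A] + K_q.
   If z^q is not in gamma_3, the map sending n in N to (1 + X)^l, for
   n = z^l mod gamma_3, and G \ N to 0, kills [A, A] + K_q modulo X^(q+1) but
   sends (z - 1)^q to X^q.  If z^q is in gamma_3, generators can be chosen with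
   [z, y] = z^q; J^q is then spanned by the (z - 1)^q x^a y^b modulo K_q, and
   conjugating (z - 1)^m x^a y^b by y for a suitable m, depending on the p-part
   of a, exhibits each of them as a commutator modulo K_q; here p is odd. *)

From HB Require Import structures.
Require Import Defs.
From mathcomp Require Import all_boot all_algebra all_fingroup all_solvable.
From mathcomp Require Import mxabelem finfield finmap ring zify.
From mathcomp.multinomials Require Import monalg.

Set Implicit Arguments.
Unset Strict Implicit.
Unset Printing Implicit Defensive.

Import GRing.Theory.
Local Open Scope ring_scope.

(** * Canonical subspaces of a ring *)

Lemma commrBl (A : nzRingType) (u v w : A) :
  (u - v) * w - w * (u - v) = (u * w - w * u) - (v * w - w * v).
Proof. by rewrite mulrBl mulrBr !opprD !opprK addrACA. Qed.

Lemma commrBr (A : nzRingType) (u v w : A) :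
  w * (u - v) - (u - v) * w = (w * u - u * w) - (w * v - v * w).
Proof. by rewrite -opprB commrBl opprD !opprB. Qed.

Section Spans.
Variable A : nzRingType.
Implicit Types (P Q S : A -> Prop) (a b : A).

Inductive aspan S : A -> Prop :=
| aspan_in a of S a : aspan S a
| aspan0 : aspan S 0
| aspanB a b of aspan S a & aspan S b : aspan S (a - b).

Lemma aspanN S a : aspan S a -> aspan S (- a).
Proof. by move=> Sa; rewrite -sub0r; apply: aspanB Sa; apply: aspan0. Qed.

Lemma aspanD S a b : aspan S a -> aspan S b -> aspan S (a + b).
Proof. by move=> Sa Sb; rewrite -[b]opprK; apply/aspanB/aspanN. Qed.

Lemma aspan_sum S (I : Type) (r : seq I) (P : pred I) (F : I -> A) :
  (forall i, P i -> aspan S (F i)) -> aspan S (\sum_(i <- r | P i) F i).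
Proof.
by move=> SF; elim/big_ind: _ => //; [apply: aspan0 | apply: aspanD].
Qed.

Lemma aspanMn S a n : aspan S a -> aspan S (a *+ n).
Proof.
by move=> Sa; elim: n => [|n IHn]; rewrite ?mulrS; [apply: aspan0|apply: aspanD].
Qed.

Lemma aspan_bind S T a :
  (forall b, S b -> aspan T b) -> aspan S a -> aspan T a.
Proof.
by move=> ST; elim=> // [|b c _ Tb _ Tc]; [apply: aspan0 | apply: aspanB].
Qed.

Lemma aspanMr S T a b :
  (forall c, S c -> aspan T (c * b)) -> aspan S a -> aspan T (a * b).
Proof.
move=> ST; elim=> // [|c d _ Tc _ Td]; first by rewrite mul0r; apply: aspan0.
by rewrite mulrBl; apply: aspanB.
Qed.

Lemma aspanMl S T a b :
  (forall c, S c -> aspan T (b * c)) -> aspan S a -> aspan T (b * a).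
Proof.
move=> ST; elim=> // [|c d _ Tc _ Td]; first by rewrite mulr0; apply: aspan0.
by rewrite mulrBr; apply: aspanB.
Qed.

Definition aeq S a b := aspan S (a - b).

Lemma aeq_refl S a : aeq S a a.
Proof. by rewrite /aeq subrr; apply: aspan0. Qed.

Lemma aeq_sym S a b : aeq S a b -> aeq S b a.
Proof. by rewrite /aeq -[b - a]opprB; apply: aspanN. Qed.

Lemma aeq_trans S a b c : aeq S a b -> aeq S b c -> aeq S a c.
Proof. by move=> ab bc; have := aspanD ab bc; rewrite /aeq addrA subrK. Qed.

Lemma aeqD S a b c d : aeq S a b -> aeq S c d -> aeq S (a + c) (b + d).
Proof. by move=> ab cd; rewrite /aeq opprD addrACA; apply: aspanD. Qed.

Lemma aeqB S a b c d : aeq S a b -> aeq S c d -> aeq S (a - c) (b - d).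
Proof.
by move=> ab cd; apply: aeqD => //; rewrite /aeq -opprD; apply: aspanN.
Qed.

Lemma aspan_aeq S a b : aeq S a b -> aspan S b -> aspan S a.
Proof. by move=> ab Sb; have := aspanD ab Sb; rewrite subrK. Qed.

Definition setA a := True.
Definition prodS P Q := aspan (fun a => exists b c, [/\ P b, Q c & a = b * c]).
Definition commS P Q :=
  aspan (fun a => exists b c, [/\ P b, Q c & a = b * c - c * b]).
Definition sumS P Q := aspan (fun a => P a \/ Q a).

Lemma prodS_in P Q a b : P a -> Q b -> prodS P Q (a * b).
Proof. by move=> Pa Qb; apply: aspan_in; exists a, b. Qed.

Lemma commS_in P Q a b : P a -> Q b -> commS P Q (a * b - b * a).
Proof. by move=> Pa Qb; apply: aspan_in; exists a, b. Qed.

Lemma sumSl P Q a : P a -> sumS P Q a.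
Proof. by move=> Pa; apply: aspan_in; left. Qed.

Lemma sumSr P Q a : Q a -> sumS P Q a.
Proof. by move=> Qa; apply: aspan_in; right. Qed.

Lemma prodSMr P Q a b : (forall c, Q c -> Q (c * b)) ->
  prodS P Q a -> prodS P Q (a * b).
Proof.
move=> Qb; apply: aspanMr => _ [c [d [Pc Qd ->]]].
by rewrite -mulrA; apply: prodS_in => //; apply: Qb.
Qed.

Lemma prodSMl P Q a b : (forall c, P c -> P (b * c)) ->
  prodS P Q a -> prodS P Q (b * a).
Proof.
move=> Pb; apply: aspanMl => _ [c [d [Pc Qd ->]]].
by rewrite mulrA; apply: prodS_in => //; apply: Pb.
Qed.

Definition com_ideal := prodS (commS setA setA) setA.
Definition com2_ideal := prodS (commS com_ideal setA) setA.
Fixpoint com_pow i :=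
  if i is j.+1 then prodS com_ideal (com_pow j) else setA.
(* The graded piece [com_pow i / com_fil i] kills [com2_ideal] in every slot of
   an [i]-fold product. *)
Fixpoint com_fil i :=
  if i is j.+1 then
    sumS (prodS com_ideal (com_fil j)) (prodS com2_ideal (com_pow j))
  else com_ideal.
Definition com_crit q :=
  forall a, com_pow q a -> sumS (commS setA setA) (com_fil q) a.

Lemma commS_ideal a b : com_ideal (a * b - b * a).
Proof. by rewrite -[_ - _]mulr1; apply/prodS_in/I/commS_in. Qed.

Lemma com_idealMr a b : com_ideal a -> com_ideal (a * b).
Proof. exact: prodSMr. Qed.

Lemma com_idealMl a b : com_ideal a -> com_ideal (b * a).
Proof.
apply: aspanMl => _ [c [d [+ _ ->]]]; rewrite mulrA => cP.
apply: (aspanMr (S := com_ideal)) => [e eP|]; first exact: com_idealMr.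
move: cP; apply: aspanMl => _ [u [v [_ _ ->]]].
have ->: b * (u * v - v * u) = (b * u * v - v * (b * u)) - (b * v - v * b) * u.
  by rewrite mulrBr mulrBl !mulrA opprB addrA subrK.
by apply: aspanB; apply: aspan_in; [apply: commS_ideal|apply/com_idealMr/commS_ideal].
Qed.

Lemma com_ideal_sqr a b : com_ideal a -> com_ideal b -> com2_ideal (a * b).
Proof.
move=> Ja; apply: aspanMl => _ [c [d [+ _ ->]]]; rewrite mulrA => cP.
apply: (prodSMr (b := d)) => //; move: cP.
apply: aspanMl => _ [u [v [_ _ ->]]].
have ->: a * (u * v - v * u) = (a * u * v - v * (a * u)) * 1 - (a * v - v * a) * u.
  by rewrite mulr1 mulrBr mulrBl !mulrA opprB addrA subrK.
by apply: aspanB; apply/prodS_in/I/commS_in => //; apply: com_idealMr.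
Qed.

Lemma com2_idealMl a b : com2_ideal a -> com2_ideal (b * a).
Proof.
apply: aspanMl => _ [c [d [+ _ ->]]]; rewrite mulrA => cP.
apply: (prodSMr (b := d)) => //; move: cP.
apply: aspanMl => _ [j [v [Jj _ ->]]].
have ->: b * (j * v - v * j) = (b * j * v - v * (b * j)) * 1 - (b * v - v * b) * j.
  by rewrite mulr1 mulrBr mulrBl !mulrA opprB addrA subrK.
apply: aspanB; last by apply: com_ideal_sqr => //; apply: commS_ideal.
by apply/prodS_in/I/commS_in => //; apply: com_idealMl.
Qed.

Lemma com_powMl i a b : com_pow i a -> com_pow i (b * a).
Proof.
by case: i => //= i; apply: prodSMl => c; apply: com_idealMl.
Qed.

Lemma com_fil0 i : com_fil i 0.
Proof. by case: i => [|i]; apply: aspan0. Qed.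

Lemma com_filS i a b : com_ideal a -> com_fil i b -> com_fil i.+1 (a * b).
Proof. by move=> Ja Kb; apply/sumSl/prodS_in. Qed.

Lemma com_pow_fil i a : com_pow i.+1 a -> com_fil i a.
Proof.
elim: i a => [|i IHi] a /=.
  by apply: aspan_bind => _ [b [c [Jb _ ->]]]; apply: com_idealMr.
apply: aspan_bind => _ [b [c [Jb Pc ->]]]; apply: com_filS => //; exact: IHi.
Qed.

Lemma com_filMl i a b : com_fil i a -> com_fil i (b * a).
Proof.
case: i => [|i] /=; first exact: com_idealMl.
apply: aspanMl => c [cP|cP]; apply: aspan_in; [left|right]; apply: prodSMl cP => d.
  exact: com_idealMl.
exact: com2_idealMl.
Qed.

Lemma com_idealX i j a b :
  com_ideal a -> com_pow j b -> com_pow (i + j) (a ^+ i * b).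
Proof.
move=> Ja Pb; elim: i => [|i IHi]; first by rewrite mul1r.
by rewrite exprS -mulrA; apply: prodS_in.
Qed.

Lemma com_fil_expr i m a b :
  com_ideal a -> (i < m)%N -> com_fil i (a ^+ m * b).
Proof.
move=> Ja im; apply: com_pow_fil; rewrite -(subnK im) addnC exprD -mulrA.
by have := com_idealX i.+1 (j := 0) Ja I; rewrite addn0; apply.
Qed.

Lemma com2_fil i a b c :
  com_ideal a -> com2_ideal b -> com_fil i.+1 (a ^+ i * (b * c)).
Proof.
move=> Ja Lb; elim: i => [|i IHi]; last by rewrite exprS -mulrA; apply: com_filS.
by rewrite expr0 mul1r; apply/sumSr/prodS_in.
Qed.

End Spans.

Section Transport.
Variables (A B : nzRingType) (f : {rmorphism A -> B}).

Lemma aspan_transport (S : A -> Prop) (T : B -> Prop) a :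
  (forall b, S b -> T (f b)) -> aspan S a -> aspan T (f a).
Proof.
move=> ST; elim=> [b /ST|| b c _ Sb _ Sc]; first exact: aspan_in.
- by rewrite rmorph0; apply: aspan0.
- by rewrite rmorphB; apply: aspanB.
Qed.

Lemma prodS_transport (P Q : A -> Prop) (P' Q' : B -> Prop) a :
  (forall b, P b -> P' (f b)) -> (forall b, Q b -> Q' (f b)) ->
  prodS P Q a -> prodS P' Q' (f a).
Proof.
move=> PP' QQ'; apply: aspan_transport => _ [b [c [Pb Qc ->]]].
by exists (f b), (f c); rewrite rmorphM; split; [apply: PP'|apply: QQ'|].
Qed.

Lemma commS_transport (P Q : A -> Prop) (P' Q' : B -> Prop) a :
  (forall b, P b -> P' (f b)) -> (forall b, Q b -> Q' (f b)) ->
  commS P Q a -> commS P' Q' (f a).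
Proof.
move=> PP' QQ'; apply: aspan_transport => _ [b [c [Pb Qc ->]]].
by exists (f b), (f c); rewrite rmorphB !rmorphM; split; [apply: PP'|apply: QQ'|].
Qed.

Lemma sumS_transport (P Q : A -> Prop) (P' Q' : B -> Prop) a :
  (forall b, P b -> P' (f b)) -> (forall b, Q b -> Q' (f b)) ->
  sumS P Q a -> sumS P' Q' (f a).
Proof.
by move=> PP' QQ'; apply: aspan_transport => b [/PP'|/QQ'] ?; [left|right].
Qed.

Lemma com_ideal_transport a : com_ideal a -> com_ideal (f a).
Proof. by apply: prodS_transport => // b; apply: commS_transport. Qed.

Lemma com2_ideal_transport a : com2_ideal a -> com2_ideal (f a).
Proof.
apply: prodS_transport => // b; apply: commS_transport => //.
exact: com_ideal_transport.
Qed.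

Lemma com_pow_transport i a : com_pow i a -> com_pow i (f a).
Proof.
elim: i a => //= i IHi a; apply: prodS_transport => //.
exact: com_ideal_transport.
Qed.

Lemma com_fil_transport i a : com_fil i a -> com_fil i (f a).
Proof.
elim: i a => /= [|i IHi] a; first exact: com_ideal_transport.
apply: sumS_transport => b; apply: prodS_transport => //.
- exact: com_ideal_transport.
- exact: com2_ideal_transport.
- exact: com_pow_transport.
Qed.

Lemma commS_setA_transport a :
  commS (@setA A) (@setA A) a -> commS (@setA B) (@setA B) (f a).
Proof. exact: commS_transport. Qed.

End Transport.

Lemma com_crit_transport (A B : nzRingType) (f : {rmorphism A -> B})
    (g : {rmorphism B -> A}) (q : nat) :
  cancel g f -> com_crit A q -> com_crit B q.
Proof.
move=> gK cA b /(com_pow_transport g)/cA.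
rewrite -{2}[b]gK; apply: sumS_transport => c.
  exact: commS_setA_transport.
exact: com_fil_transport.
Qed.

(** * Group algebras and relative augmentation ideals *)

(* An abstract presentation of an algebra as the group algebra of [G]: working
   with it keeps unification from unfolding the operations of [malg]. *)
Record group_basis (R : comNzRingType) (G : finGroupType) (A : algType R) :=
  GroupBasis {
    gb :> G -> A;
    coef : G -> {linear A -> R^o};
    gbM : {morph gb : g h / (g * h)%g >-> g * h};
    gb1 : gb 1%g = 1;
    coef_gb : forall g h, coef g (gb h) = (h == g)%:R;
    gb_sum : forall a, a = \sum_g coef g a *: gb g }.

Section GroupAlgebraBasis.
Variables (R : comNzRingType) (G : finGroupType).

Definition ga_coef (g : G) (a : group_algebra R G) : R := mcoeff g a.

Lemma ga_coef_is_linear g : linear (ga_coef g : group_algebra R G -> R^o).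
Proof. by move=> c a b; rewrite /ga_coef mcoeffD mcoeffZ. Qed.
HB.instance Definition _ g :=
  GRing.isLinear.Build R (group_algebra R G) R^o _ (ga_coef g)
    (ga_coef_is_linear g).

Definition ga_basis : group_basis G (group_algebra R G).
Proof.
pose e g : group_algebra R G := ga_elt 1 g.
have coef_e g h : ga_coef g (e h) = (h == g)%:R.
  by rewrite /ga_coef /e mcoeffU.
refine (@GroupBasis _ _ _ e ga_coef _ _ coef_e _) => //.
by move=> g h; rewrite -[RHS]/(ga_mul _ _) ga_mulUU mulr1.
move=> a; apply/malgP => h; rewrite -!/(ga_coef h _).
rewrite linear_sum (bigD1 h) //= big1 ?addr0 => [|g /negPf gh].
  by rewrite linearZ /= coef_e eqxx [RHS]mulr1.
by rewrite linearZ /= coef_e gh [LHS]mulr0.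
Defined.

End GroupAlgebraBasis.

Section Basis.
Variables (R : comNzRingType) (G : finGroupType) (A : algType R).
Variable e : group_basis G A.
Implicit Types (a b : A) (g h : G).

Lemma gbX g n : e (g ^+ n)%g = e g ^+ n.
Proof. by elim: n => [|n IHn]; rewrite ?gb1 // expgS gbM IHn exprS. Qed.

Lemma coef_inj a b : (forall g, coef e g a = coef e g b) -> a = b.
Proof.
by move=> eq_ab; rewrite [a](gb_sum e) [b](gb_sum e); apply: eq_bigr => g _; rewrite eq_ab.
Qed.

Section Extend.
Variables (V : lmodType R) (F : G -> V).
Definition gb_ext a := \sum_g coef e g a *: F g.
Lemma gb_ext_is_linear : linear gb_ext.
Proof.
move=> c a b; rewrite /gb_ext scaler_sumr -big_split /=; apply: eq_bigr => g _.
by rewrite linearP scalerDl scalerA.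
Qed.
HB.instance Definition _ :=
  GRing.isLinear.Build R A V _ gb_ext gb_ext_is_linear.
Lemma gb_ext_gb g : gb_ext (e g) = F g.
Proof.
rewrite /gb_ext (bigD1 g) //= big1 ?addr0 ?coef_gb ?eqxx ?scale1r // => h /negPf hg.
by rewrite coef_gb eq_sym hg scale0r.
Qed.
End Extend.

End Basis.

Section PrimeField.
Variable p : nat.

Lemma Fp_scale (V : lmodType 'F_p) (c : 'F_p) (v : V) : c *: v = v *+ c.
Proof. by rewrite -scaler_nat natr_Zp. Qed.

Lemma aspanZ (A : algType 'F_p) (S : A -> Prop) (c : 'F_p) a :
  aspan S a -> aspan S (c *: a).
Proof. by rewrite Fp_scale; apply: aspanMn. Qed.

Lemma aspan_gb (G : finGroupType) (A : algType 'F_p) (e : group_basis G A)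
    (B : nzRingType) (S : B -> Prop) (f : A -> B) :
  {morph f : a b / a - b} -> (forall g, aspan S (f (e g))) ->
  forall a, aspan S (f a).
Proof.
move=> fB fge a.
have f0: f 0 = 0 by rewrite -[in LHS](subrr 0) fB subrr.
have fD b c : f (b + c) = f b + f c.
  by rewrite -{1}[c]opprK -(sub0r c) !fB f0 sub0r opprK.
rewrite [a](gb_sum e); elim/big_ind: _ => [|b c Sb Sc|g _].
- by rewrite f0; apply: aspan0.
- by rewrite fD; apply: aspanD.
have ->: f (coef e g a *: e g) = f (e g) *+ coef e g a.
  rewrite Fp_scale; elim: (nat_of_ord _) => [|n IHn]; first by rewrite !mulr0n.
  by rewrite !mulrS fD IHn.
exact: aspanMn.
Qed.
End PrimeField.

Lemma gen_ind (gT : finGroupType) (A : {set gT}) (P : gT -> Prop) :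
  P 1%g -> (forall x y, P x -> P y -> P (x * y)%g) ->
  (forall x, x \in A -> P x) -> forall x, x \in <<A>>%g -> P x.
Proof.
move=> P1 PM PA x /gen_prodgP[n [c cA ->]].
by elim/big_ind: _ => // i _; apply: PA.
Qed.

Section RelativeAugmentation.
Variables (p : nat) (G : finGroupType) (kG : algType 'F_p).
Variable e : group_basis G kG.
Implicit Types (a b : kG) (g h m : G) (M : {group G}).

Definition rel_aug (M : {set G}) : kG -> Prop :=
  aspan (fun a => exists m g, m \in M /\ a = (e m - 1) * e g).
Definition rel_aug2 (M : {set G}) : kG -> Prop :=
  aspan (fun a => exists m g, m \in M /\ a = (e m - 1) * (e g - 1)).

Lemma rel_augMr M a b : rel_aug M a -> rel_aug M (a * b).
Proof.
move=> Ma; rewrite [b](gb_sum e) mulr_sumr; apply: aspan_sum => h _.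
rewrite -scalerAr; apply: aspanZ; move: Ma; apply: aspanMr => _ [m [g [Mm ->]]].
by apply: aspan_in; exists m, (g * h)%g; rewrite (gbM e) mulrA.
Qed.

Lemma rel_aug_in M m a : m \in M -> rel_aug M ((e m - 1) * a).
Proof.
move=> Mm; apply: rel_augMr; apply: aspan_in.
by exists m, 1%g; rewrite (gb1 e) mulr1.
Qed.

Lemma rel_aug_sub M : (M <| [set: G])%g -> ([set: G]^`(1) \subset M)%g ->
  forall g h, rel_aug M (e g * e h - e h * e g).
Proof.
move=> nM sM g h; have ->: e g * e h - e h * e g
    = (e [~ g^-1, h^-1]%g - 1) * e ((h * g)%g).
  rewrite mulrBl mul1r -!(gbM e) commgEl conjgE !invgK !mulgA.
  by rewrite mulgKV mulgKV.
by apply/rel_aug_in/(subsetP sM); rewrite derg1 mem_commg ?inE.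
Qed.

Local Notation N := ([set: G]^`(1))%g.

Lemma nor_der : (N <| [set: G])%g. Proof. exact: der_normal. Qed.
Hint Resolve nor_der : core.

Lemma com_ideal_in_rel_aug a : com_ideal a -> rel_aug N a.
Proof.
apply: aspan_bind => _ [b [c [+ _ ->]]]; move=> Cb; apply: rel_augMr; move: Cb.
apply: aspan_bind => _ [u [v [_ _ ->]]].
apply: (aspan_gb (e := e) (f := fun u => u * v - v * u)) => [x y|g].
  exact: commrBl.
apply: (aspan_gb (e := e) (f := fun v => _ * v - v * _)) => [x y|h]; last exact: rel_aug_sub.
exact: commrBr.
Qed.

Lemma der_com_ideal m : m \in N -> com_ideal (e m - 1).
Proof.
rewrite derg1; move: m; apply: gen_ind => [|x y Jx Jy|_ /imset2P[x y _ _ ->]].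
- by rewrite (gb1 e) subrr; apply: aspan0.
- have ->: e ((x * y)%g) - 1 = (e x - 1) * e y + (e y - 1).
    by rewrite (gbM e) mulrBl mul1r addrA subrK.
  by apply: aspanD => //; apply: com_idealMr.
- have ->: e [~ x, y]%g - 1 = e ((x^-1 * y^-1)%g) * (e x * e y - e y * e x).
    by rewrite mulrBr -!(gbM e) commgEl conjgE !mulgA mulgKV mulVg (gb1 e).
  exact/com_idealMl/commS_ideal.
Qed.

Lemma com_idealP a : com_ideal a <-> rel_aug N a.
Proof.
split=> [|]; first exact: com_ideal_in_rel_aug.
apply: aspan_bind => _ [m [g [Nm ->]]]; exact/com_idealMr/der_com_ideal.
Qed.

Section Kernel.
Variable M : {group G}.
Definition crep g := repr (M :* g)%g.
Definition fold_coset : {linear kG -> kG} := gb_ext e (fun g => e (crep g)).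

Lemma crepM m g : m \in M -> crep (m * g) = crep g.
Proof.
by move=> Mm; congr repr; apply/rcoset_eqP; rewrite mem_rcoset mulgK.
Qed.

Lemma crep_crep g : crep (crep g) = crep g.
Proof. by rewrite /crep rcoset_repr. Qed.

Lemma crepV g : (g * (crep g)^-1)%g \in M.
Proof.
have /rcosetP[m Mm ->]: crep g \in (M :* g)%g by apply: mem_repr_rcoset.
by rewrite invMg mulgA mulgV mul1g groupV.
Qed.

Lemma fold_coset_ge g : fold_coset (e g) = e (crep g).
Proof. exact: gb_ext_gb. Qed.

Lemma fold_coset_sub a : rel_aug M (a - fold_coset a).
Proof.
rewrite {1}[a](gb_sum e) [fold_coset a]/(gb_ext e _ _) /gb_ext -sumrB.
apply: aspan_sum => g _; rewrite -scalerBr; apply: aspanZ.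
have ->: e g - e (crep g) = (e ((g * (crep g)^-1)%g) - 1) * e (crep g).
  by rewrite mulrBl mul1r -gbM mulgKV.
exact/rel_aug_in/crepV.
Qed.

Lemma rel_augP a : rel_aug M a <-> fold_coset a = 0.
Proof.
split=> [|a0]; last by rewrite -[a]subr0 -a0; apply: fold_coset_sub.
elim=> [_ [m [g [Mm ->]]]||b c _ b0 _ c0]; last by rewrite linearB b0 c0 subr0.
  by rewrite mulrBl mul1r -gbM linearB /= !fold_coset_ge (crepM g Mm) // subrr.
exact: linear0.
Qed.
End Kernel.

Lemma rel_aug2P M a :
  rel_aug2 M a <-> prodS (rel_aug M) (rel_aug [set: G]) a.
Proof.
split; apply: aspan_bind => d; last case=> b [c [Mb Gc ->]].
  case=> m [g [Mm ->]].
  have aug (K : {group G}) k : k \in K -> rel_aug K (e k - 1).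
    by move=> Kk; rewrite -[_ - _]mulr1; apply: rel_aug_in.
  by apply: aspan_in; exists (e m - 1), (e g - 1); split=> //; apply: aug; rewrite ?inE.
move: Gc; apply: aspanMl => _ [h [k [_ ->]]]; move: Mb.
apply: aspanMr => _ [m [g [Mm ->]]].
have ->: (e m - 1) * e g * ((e h - 1) * e k) =
    (e m - 1) * (e (g * h * k)%g - 1) - (e m - 1) * (e (g * k)%g - 1).
  rewrite -mulrBr -mulrA; congr (_ * _); rewrite opprB addrA subrK.
  by rewrite mulrA mulrBr mulr1 mulrBl -!gbM.
by apply: aspanB; apply: aspan_in; [exists m, (g * h * k)%g | exists m, (g * k)%g].
Qed.

Section Frattini.
Hypothesis p_pr : prime p.
Variable M : {group G}.
Hypothesis pM : (p.-group M)%g.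

Local Notation D := (fun a => exists m g, m \in M /\ a = (e m - 1) * (e g - 1)).
Local Notation "a == b" := (aeq D a b).

Lemma rel_aug2M m g : m \in M -> e ((m * g)%g) - 1 == (e m - 1) + (e g - 1).
Proof.
move=> Mm; apply: aspan_in; exists m, g; split=> //.
by rewrite mulrBl mulrBr -gbM mulr1 mul1r opprD addrA opprB addrA subrK.
Qed.

Lemma rel_aug2_div m n : m \in M -> n \in M ->
  rel_aug2 M (e (m * n^-1)%g - 1) <-> rel_aug2 M (e m - e n).
Proof.
move=> Mm Mn; set x := (m * n^-1)%g.
have xn : e m - e n - (e x - 1) = (e x - 1) * (e n - 1).
  by rewrite mulrBr mulr1 mulrBl mul1r -gbM mulgKV.
have Dx : rel_aug2 M (e m - e n - (e x - 1)).
  by rewrite xn; apply: aspan_in; exists x, n; rewrite groupM ?groupV.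
by split=> D'; [apply: aspan_aeq Dx D' | apply: aspan_aeq (aeq_sym Dx) D'].
Qed.

Lemma rel_aug_repr a : rel_aug M a -> exists2 m, m \in M & a == e m - 1.
Proof.
elim=> [_ [m [g [Mm ->]]]||b c _ [m Mm Mb] _ [n Mn Mc]].
- exists m => //; rewrite /aeq -[X in _ - X]mulr1 -mulrBr.
  by apply: aspan_in; exists m, g.
- by exists 1%g => //; rewrite (gb1 e) subrr; apply: aeq_refl.
exists (m * n^-1)%g; first by rewrite groupM ?groupV.
apply: aeq_trans (aeqB Mb Mc) _; apply: aeq_sym.
have := rel_aug2M n (m := (m * n^-1)%g).
rewrite mulgKV groupM ?groupV // => /(_ isT) Mmn.
have := aeqB (aeq_sym Mmn) (aeq_refl _ (e n - 1)); rewrite addrK; exact.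
Qed.

Lemma Phi_rel_aug2 m : m \in 'Phi(M)%g -> rel_aug2 M (e m - 1).
Proof.
pose Q m := m \in M /\ rel_aug2 M (e m - 1).
have genQ (A : {set G}) : (forall x, x \in A -> Q x) -> forall x, x \in <<A>>%g -> Q x.
  apply: gen_ind => [|x y [Mx Dx] [My Dy]].
    by split=> //; rewrite gb1 subrr; apply: aspan0.
  split; first exact: groupM.
  by apply: aspan_aeq (rel_aug2M y Mx) _; apply: aspanD.
suff: m \in 'Phi(M)%g -> Q m by move=> PQ /PQ[].
move: m; rewrite (Phi_joing pM) derg1 (MhoE _ pM) joingE.
apply: (genQ _) => x /setUP[]; move: x; apply: (genQ _) => x.
- case/imset2P=> y z My Mz ->; split; first by rewrite groupR.
  have /aeq_sym yz := rel_aug2M z My.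
  have := rel_aug2M [~ y, z]%g (groupM Mz My); rewrite -commgC => /(aeq_trans yz).
  have /(aeqD (aeq_refl _ (e [~ y, z]%g - 1))) := rel_aug2M y Mz.
  rewrite addrC => /[swap]/aeq_trans/[apply]/aeq_sym.
  by rewrite /aeq [e y - 1 + _]addrC [e [~ y, z]%g - 1 + _]addrC addrAC subrr add0r.
case/imsetP=> y My ->; rewrite expn1; split; first by rewrite groupX.
have powM n : e (y ^+ n)%g - 1 == (e y - 1) *+ n.
  elim: n => [|n IHn]; first by rewrite gb1 subrr; apply: aeq_refl.
  rewrite expgS mulrS; apply: aeq_trans (rel_aug2M _ My) _.
  by apply: aeqD IHn; apply: aeq_refl.
apply: aspan_aeq (powM p) _.
by rewrite -scaler_nat pchar_Fp_0 // scale0r; apply: aspan0.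
Qed.

(* The cosets of [M] split [kG] as a free left [kM]-module, so a homomorphism
   from [M] to an elementary abelian group extends to [kG]. *)
Lemma rel_aug2_Phi m : m \in M -> rel_aug2 M (e m - 1) -> m \in 'Phi(M)%g.
Proof.
move=> Mm Dm; have abV := Phi_quotient_abelem pM.
have [V1 | ntV] := eqVneq (M / 'Phi(M))%g 1%g.
  have := mem_quotient 'Phi(M)%G Mm; rewrite V1 => /set1P/coset_idr -> //.
  by rewrite (subsetP (normal_norm (Phi_normal M))).
pose rho x := abelem_rV abV ntV (coset 'Phi(M)%g x).
have nM : {subset M <= 'N('Phi(M))%g} by apply/subsetP/normal_norm/Phi_normal.
have rhoM : {in M &, forall x y, rho (x * y)%g = rho x + rho y}.
  move=> x y Mx My; rewrite /rho morphM ?nM //; apply: abelem_rV_M; exact: mem_quotient.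
pose T : {linear kG -> _} := gb_ext e (fun g => rho (g * (crep M g)^-1)%g).
have TM x g : x \in M -> T (e (x * g)%g) = rho x + T (e g).
  move=> Mx; rewrite ![T _]gb_ext_gb crepM // -mulgA rhoM // crepV //.
have T1 x : x \in M -> T (e x) = rho x + T 1.
  by move=> Mx; rewrite -{1}[x]mulg1 TM // gb1.
have T0 a : rel_aug2 M a -> T a = 0.
  elim=> [_ [x [g [Mx ->]]]||b c _ b0 _ c0]; last by rewrite linearB b0 c0 subr0.
    rewrite mulrBl mul1r mulrBr mulr1 -gbM !(linearB T) TM //.
    by rewrite (T1 x) // [rho x + T _]addrC addrKA subrr.
  exact: linear0.
have := T0 _ Dm; rewrite linearB /= T1 // addrK => rho0.
apply: coset_idr; rewrite ?nM //.
have rV_inj := @abelem_rV_inj _ _ _ abV ntV.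
apply: rV_inj; rewrite ?group1 ?mem_quotient //.
by rewrite abelem_rV_1 -rho0.
Qed.

End Frattini.
End RelativeAugmentation.

(** * Centers, and orders determined by the group algebra *)

Section Center.
Variables (p : nat) (G : finGroupType) (A : algType 'F_p).
Variable e : group_basis G A.
Implicit Types (a b : A) (g h t : G).

Lemma gb_eq0 (f : A -> 'F_p) :
  {morph f : a b / a - b} -> (forall g, f (e g) = 0) -> forall a, f a = 0.
Proof.
move=> fB f0 a; have: aspan (eq 0) (f a).
  by apply: (aspan_gb (e := e) fB) => g; rewrite f0; apply: aspan0.
by elim=> // b c _ -> _ ->; rewrite subrr.
Qed.

Lemma coef_mulC t a b : t \in 'Z([set: G])%g -> coef e t (a * b) = coef e t (b * a).
Proof.
move=> /centerP[_ Zt]; apply/eqP; rewrite -subr_eq0 -linearB /=; apply/eqP.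
pose f a b := coef e t (a * b - b * a).
apply: (gb_eq0 (f := f^~ b)) => [x y|g]; rewrite /f.
  by rewrite commrBl linearB.
apply: (gb_eq0 (f := f (e g))) => [x y|h]; rewrite /f.
  by rewrite commrBr linearB.
rewrite linearB /= -!gbM !coef_gb; apply/eqP; rewrite subr_eq0; apply/eqP.
congr (_ %:R); congr nat_of_bool; apply/eqP/eqP => [gh|hg].
  by rewrite -[h](mulKg g) gh -mulgA Zt ?inE // mulKg.
by rewrite -[g](mulKg h) hg -mulgA Zt ?inE // mulKg.
Qed.

Lemma coef_commS t a :
  t \in 'Z([set: G])%g -> commS (@setA A) (@setA A) a -> coef e t a = 0.
Proof.
move=> Zt; elim=> [_ [b [c [_ _ ->]]]||b c _ b0 _ c0].
- by rewrite linearB /= (coef_mulC _ _ Zt) subrr.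
- exact: linear0.
- by rewrite linearB /= b0 c0 subrr.
Qed.

Lemma coef_conj a g x : (forall b, a * b = b * a) ->
  coef e (g ^ x)%g a = coef e g a.
Proof.
move=> Za; rewrite -{1}[a]mul1r -(gb1 e) -(mulVg x) gbM -mulrA -Za mulrA.
pose f a := coef e (g ^ x)%g (e (x^-1)%g * a * e x) - coef e g a.
apply/eqP; rewrite -subr_eq0 -/(f a); apply/eqP.
apply: (gb_eq0 (f := f)) => [u v|h]; rewrite /f.
  rewrite mulrBr mulrBl !(linearB (coef e _)).
  move: (coef _ _ _) (coef _ _ _) (coef _ _ _) (coef _ _ _) => /= x1 x2 x3 x4.
  by rewrite !opprD !opprK addrACA.
by rewrite -!gbM !coef_gb -mulgA -conjgE (inj_eq (conjg_inj x)) subrr.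
Qed.

(* Modulo [commS] every basis element equals the chosen representative of its
   conjugacy class, and a noncentral class has order divisible by [p]. *)
Lemma central_commS a : prime p -> (p.-group [set: G])%g ->
  (forall b, a * b = b * a) ->
  (forall t, t \in 'Z([set: G])%g -> coef e t a = 0) ->
  commS (@setA A) (@setA A) a.
Proof.
move=> p_pr pG Za Z0; pose rep g := repr (g ^: [set: G])%g.
have repP g : exists x, rep g = (g ^ x)%g.
  have /imsetP[x _ ->]: rep g \in (g ^: [set: G])%g.
    by apply: (mem_repr g); apply: class_refl.
  by exists x.
have rep_class g : ((rep g) ^: [set: G] = g ^: [set: G])%g.
  by have [x ->] := repP g; rewrite classGidl // inE.
have ->: a = \sum_g coef e g a *: (e g - e (rep g)) + \sum_g coef e g a *: e (rep g).
  rewrite -big_split {1}[a](gb_sum e); apply: eq_bigr => g _ /=.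
  by rewrite -scalerDr subrK.
apply: aspanD.
  apply: aspan_sum => g _; apply: aspanZ; have [x ->] := repP g.
  have ->: e g - e (g ^ x)%g = e x * e (x^-1 * g)%g - e (x^-1 * g)%g * e x.
    by rewrite -!gbM mulKVg conjgE mulgA.
  exact: commS_in.
rewrite (partition_big rep predT) //= big1 => [|c _]; first exact: aspan0.
under eq_bigr => g /eqP-> do [].
rewrite -scaler_suml; case: (eqVneq (rep c) c) => [repc|nrepc]; last first.
  rewrite big_pred0 ?scale0r // => g; apply/eqP => gc.
  by case/eqP: nrepc; rewrite -gc; congr (repr _); apply: rep_class.
have -> : \sum_(g | rep g == c) coef e g a = \sum_(g in (c ^: [set: G])%g) coef e c a.
  apply: eq_big => [g|g /eqP gc].
    apply/eqP/idP => [<-|/class_eqP cg]; first by rewrite rep_class class_refl.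
    by rewrite /rep cg -/(rep c).
  by have [x gx] := repP g; rewrite -gc gx coef_conj.
rewrite sumr_const.
have [Zc|nZc] := boolP (c \in 'Z([set: G])%g); first by rewrite Z0 // mul0rn scale0r.
have: (p %| #|(c ^: [set: G])%g|)%N.
  rewrite -index_cent1; have := pnat_dvd (dvdn_indexg [set: G] 'C_([set: G])[c]) pG.
  case/p_natP=> [[|k] idx]; first (move/eqP: idx); last by rewrite idx expnS dvdn_mulr.
  rewrite expn0 indexg_eq1 subsetI subxx /= => /subsetP cG.
  case/negP: nZc; apply/centerP; split=> [|x _]; first by rewrite inE.
  by apply/esym/cent1P; rewrite cG ?inE.
have F0 (x : 'F_p) : x *+ p = 0 by rewrite -mulr_natr pchar_Fp_0 // mulr0.
by case/dvdnP=> k ->; rewrite mulrnA [_ *+ p]F0 scale0r.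
Qed.

End Center.

Section Counting.
Variables (p : nat) (p_pr : prime p) (G H : finGroupType).
Variables (A B : algType 'F_p) (eG : group_basis G A) (eH : group_basis H B).

Definition supported (K : finGroupType) (C : algType 'F_p) (e : group_basis K C)
  (S : {set K}) (a : C) := forall g, g \notin S -> coef e g a = 0.

Lemma leq_card_support (R : {set G}) (S : {set H}) (f : {linear A -> B}) :
  (forall a, supported eG R a -> supported eH S (f a)) ->
  (forall a, supported eG R a -> f a = 0 -> a = 0) -> (#|R| <= #|S|)%N.
Proof.
move=> fS f_inj.
pose u (w : {ffun G -> 'F_p}) := \sum_g w g *: eG g.
have uE w g : coef eG g (u w) = w g.
  rewrite linear_sum (bigD1 g) //= big1 ?addr0 => [|h /negPf hg].
    by rewrite linearZ /= coef_gb eqxx [LHS]mulr1.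
  by rewrite linearZ /= coef_gb hg [LHS]mulr0.
pose D := pffun_on (0 : 'F_p) (mem R) predT.
have suppD w : w \in D -> supported eG R (u w).
  move=> /pffun_onP[/supportP wR _] g gR; rewrite uE; exact: wR.
pose F w := [ffun h => coef eH h (f (u w)) : 'F_p].
have F_inj : {in D &, injective F}.
  move=> w1 w2 /suppD D1 /suppD D2 eqF.
  have e0: u w1 - u w2 = 0.
    apply: f_inj => [g gR|]; first by rewrite linearB /= D1 // D2 // subrr.
    apply: (coef_inj (e := eH)) => h; rewrite linear0 linearB linearB /=.
    by have /ffunP/(_ h) := eqF; rewrite !ffunE => ->; rewrite subrr.
  by apply/ffunP => g; rewrite -!uE; move/eqP: e0; rewrite subr_eq0 => /eqP ->.
have: (#|D| <= #|pffun_on (0%R : 'F_p) (mem S) predT|)%N.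
  rewrite -(card_in_imset F_inj); apply/subset_leq_card/subsetP => _ /imsetP[w Dw ->].
  apply/pffun_onP; split=> //; apply/supportP => h; rewrite ffunE => hS.
  by apply: (fS _ (suppD _ Dw)).
by rewrite !card_pffun_on card_Fp // leq_exp2l ?prime_gt1.
Qed.
End Counting.

Section Restrict.
Variables (R : comNzRingType) (G : finGroupType) (A : algType R).
Variables (e : group_basis G A) (S : {set G}).

Definition gb_restrict : {linear A -> A} :=
  gb_ext e (fun g => if g \in S then e g else 0).

Lemma coef_restrict a g : coef e g (gb_restrict a) = if g \in S then coef e g a else 0.
Proof.
rewrite [gb_restrict a]/(gb_ext e _ _) /gb_ext linear_sum (bigD1 g) //=.
rewrite big1 ?addr0 => [|h /negPf hg].
  rewrite linearZ /=; case: ifP => _; first by rewrite coef_gb eqxx [LHS]mulr1.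
  by rewrite linear0 scaler0.
rewrite linearZ /=; case: ifP => _; last by rewrite linear0 scaler0.
by rewrite coef_gb hg scaler0.
Qed.
End Restrict.

Section Invariants.
Variables (p : nat) (p_pr : prime p) (G H : finGroupType).
Variables (A B : algType 'F_p) (eG : group_basis G A) (eH : group_basis H B).
Variables (f : {lrmorphism A -> B}) (g : {lrmorphism B -> A}).
Hypotheses (fK : cancel f g) (gK : cancel g f).

Lemma iso_leq_card : (#|G| <= #|H|)%N.
Proof.
rewrite -[#|G|]cardsT -[#|H|]cardsT.
apply: (leq_card_support p_pr (eG := eG) (eH := eH) (f := f)) => [a _ h|a _ fa0].
  by rewrite inE.
by rewrite -[a]fK fa0 rmorph0.
Qed.

Section Center.
Hypothesis pH : (p.-group [set: H])%g.

Lemma supported_central (K : finGroupType) (C : algType 'F_p) (e : group_basis K C) a :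
  supported e 'Z([set: K])%g a -> forall b, a * b = b * a.
Proof.
move=> Za b; apply/eqP; rewrite -subr_eq0; apply/eqP.
rewrite [a](gb_sum e) mulr_suml mulr_sumr -sumrB big1 // => z _.
have [/centerP[_ Zz]|nZz] := boolP (z \in 'Z([set: K])%g); last first.
  by rewrite Za // scale0r mul0r mulr0 subrr.
rewrite -scalerAl -scalerAr -scalerBr [b](gb_sum e) mulr_suml mulr_sumr -sumrB.
rewrite big1 ?scaler0 // => k _.
by rewrite -scalerAl -scalerAr -!gbM Zz ?inE // subrr.
Qed.

Lemma center_image a : supported eG 'Z([set: G])%g a ->
  commS (@setA B) (@setA B) (f a - gb_restrict eH 'Z([set: H])%g (f a)).
Proof.
move=> /supported_central Za; apply: (central_commS (e := eH) p_pr pH) => [b|t Zt].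
  rewrite mulrBl mulrBr; congr (_ - _); first by rewrite -[b]gK -!rmorphM Za.
  by apply: (supported_central (e := eH)) => h /negPf nZh; rewrite coef_restrict nZh.
by rewrite linearB /= coef_restrict Zt subrr.
Qed.

Lemma iso_leq_center : (#|'Z([set: G])%g| <= #|'Z([set: H])%g|)%N.
Proof.
apply: (leq_card_support p_pr (eG := eG) (eH := eH)
          (f := gb_restrict eH 'Z([set: H])%g \o f)) => [a _ h /negPf nZh|a Za fa0].
  by rewrite /= coef_restrict nZh.
have {}fa0: gb_restrict eH 'Z([set: H])%g (f a) = 0 by exact: fa0.
have := center_image Za; rewrite fa0 subr0 => /(commS_setA_transport g) Ca.
have {}Ca : commS (@setA A) (@setA A) a by rewrite -[a]fK.
apply: (coef_inj (e := eG)) => t; rewrite linear0.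
have [Zt|/Za //] := boolP (t \in 'Z([set: G])%g); exact: coef_commS Ca.
Qed.
End Center.

Local Notation NG := ([set: G]^`(1))%G.
Local Notation NH := ([set: H]^`(1))%G.

Lemma card_crep (K : finGroupType) (N T : {group K}) :
  #|[set crep N x | x in T]| = #|T : N|%g.
Proof.
have ->: [set crep N x | x in T] = [set repr X | X in rcosets N T].
  by rewrite /rcosets -imset_comp; apply: eq_imset => x; rewrite /= rcosetE.
rewrite card_in_imset // => _ _ /rcosetsP[x _ ->] /rcosetsP[y _ ->] eq_r.
by rewrite -(rcoset_repr N x) eq_r rcoset_repr.
Qed.

Lemma iso_leq_index (T : {group G}) (T' : {group H}) :
  (forall a, supported eG T a ->
     exists2 b, supported eH T' b & com_ideal (f a - b)) ->
  (#|T : NG|%g <= #|T' : NH|%g)%N.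
Proof.
move=> TT'; rewrite -!card_crep.
pose s r := odflt 1%g [pick t | (t \in T) && (crep NG t == r)].
have sP r : r \in [set crep NG x | x in T] -> s r \in T /\ crep NG (s r) = r.
  case/imsetP=> x Tx ->; rewrite /s; case: pickP => /= [t /andP[Tt /eqP]//|].
  by move/(_ x); rewrite Tx eqxx.
apply: (leq_card_support p_pr (eG := eG) (eH := eH) (f := fold_coset eH NH \o f)).
  move=> a Ra h Rh.
  pose u := \sum_r coef eG r a *: eG (s r).
  have [b Tb fub]: exists2 b, supported eH T' b & com_ideal (f u - b).
    apply: TT' => t nTt; rewrite linear_sum big1 // => r _; rewrite linearZ /= coef_gb.
    have [/sP[Ts _]|/Ra->] := boolP (r \in [set crep NG x | x in T]); last exact: scale0r.
    by case: eqP => [st|_]; [rewrite -st Ts in nTt | rewrite scaler0].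
  have au : com_ideal (a - u).
    apply/(com_idealP eG); rewrite [a](gb_sum eG) -sumrB; apply: aspan_sum => r _.
    rewrite -scalerBr.
    have [/sP[_ sr]|/Ra->] := boolP (r \in [set crep NG x | x in T]); last first.
      by rewrite scale0r; apply: aspan0.
    apply: aspanZ; rewrite -opprB -{2}sr -(fold_coset_ge eG); apply: aspanN.
    exact: fold_coset_sub.
  have /(com_idealP eH)/rel_augP : com_ideal (f a - b).
    have := aspanD (com_ideal_transport f au) fub.
    by rewrite rmorphB addrA subrK.
  rewrite linearB /= => /eqP; rewrite subr_eq0 => /eqP ->.
  rewrite [fold_coset _ _ b]/(gb_ext _ _ b) /gb_ext linear_sum big1 // => k _.
  rewrite linearZ /= coef_gb; case: eqP => [kh|_]; last exact: scaler0.
  rewrite Tb ?scale0r //; apply: contra Rh => Tk; rewrite -kh.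
  exact: imset_f.
move=> a Ra /= /rel_augP/(com_idealP eH)/(com_ideal_transport g) Ja.
have {Ja} /(com_idealP eG)/rel_augP <-: com_ideal a by rewrite -[a]fK.
rewrite {1}[a](gb_sum eG) [RHS]/(gb_ext _ _ a) /gb_ext; apply: eq_bigr => r _.
have [/imsetP[x _ rx]|/Ra->] := boolP (r \in [set crep NG x | x in T]).
  by congr (_ *: eG _); rewrite rx crep_crep.
by rewrite !scale0r.
Qed.

Lemma iso_leq_index_der : (#|[set: G] : NG|%g <= #|[set: H] : NH|%g)%N.
Proof.
apply: (iso_leq_index (T := [set: G]%G) (T' := [set: H]%G)) => a _.
by exists (f a) => [h|]; rewrite ?inE // subrr; apply: aspan0.
Qed.

Lemma iso_leq_index_center : (p.-group [set: H])%g ->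
  (#|'Z([set: G]) : NG|%g <= #|'Z([set: H]) : NH|%g)%N.
Proof.
move=> pH; apply: (iso_leq_index (T := 'Z([set: G])%G) (T' := 'Z([set: H])%G)) => a Za.
exists (gb_restrict eH 'Z([set: H])%g (f a)) => [h /negPf nZh|].
  by rewrite coef_restrict nZh.
have := center_image pH Za; apply: aspan_bind => _ [b [c [_ _ ->]]].
exact: commS_ideal.
Qed.

Lemma iso_rel_aug a : (p.-group [set: G])%g ->
  rel_aug eG [set: G] a -> rel_aug eH [set: H] (f a).
Proof.
move=> pG; pose eps : {linear B -> ('F_p)^o} := gb_ext eH (fun _ => 1 : ('F_p)^o).
have eps_gb h : eps (eH h) = 1 by exact: gb_ext_gb.
have epsE b : rel_aug eH [set: H] (b - eps b *: 1).
  rewrite {1}[b](gb_sum eH) [eps b]/(gb_ext _ _ b) /gb_ext scaler_suml -sumrB.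
  apply: aspan_sum => h _; rewrite -scalerA -scalerBr; apply: aspanZ.
  rewrite [X in _ - X]scale1r -[_ - _]mulr1; apply: (rel_aug_in eH (M := [set: H]%G)).
  by rewrite inE.
have epsM b c : eps (b * c) = eps b * eps c.
  apply/eqP; rewrite -subr_eq0; apply/eqP.
  apply: (gb_eq0 (e := eH) (f := fun b => eps (b * c) - eps b * eps c)) => [u v|h].
    rewrite mulrBl !(linearB eps) mulrBl !opprD !opprK addrACA.
    by congr (_ + _).
  apply: (gb_eq0 (e := eH) (f := fun c => eps (eH h * c) - eps (eH h) * eps c)) => [u v|k].
    rewrite mulrBr !(linearB eps) mulrBr !opprD !opprK addrACA.
    by congr (_ + _).
  by rewrite -gbM !eps_gb mulr1 subrr.
have eps1 : eps 1 = 1 by rewrite -(gb1 eH).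
have epsX b n : eps (b ^+ n) = eps b ^+ n.
  by elim: n => // n IHn; rewrite !exprS epsM IHn.
have eps_f m : eps (f (eG m)) = 1.
  have [n mn] : exists n, (m ^+ (p ^ n) = 1)%g.
    have /p_natP[n on] : (p.-elt m)%g by apply: (mem_p_elt pG); rewrite inE.
    by exists n; rewrite -on expg_order.
  have : eps (f (eG m)) ^+ (p ^ n) = 1 by rewrite -epsX -rmorphXn -gbX mn gb1 rmorph1.
  elim: n {mn} => [|n IHn]; first by rewrite expr1.
  have Fp_exp (x : 'F_p) : x ^+ p = x by rewrite -[RHS]expf_card card_Fp.
  by rewrite expnS exprM [_ ^+ p]Fp_exp.
elim=> [_ [m [h [_ ->]]]||b c _ Ib _ Ic].
- rewrite rmorphM; apply: rel_augMr; have := epsE (f (eG m - 1)).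
  by rewrite linearB /= !linearB /= eps_f rmorph1 eps1 subrr scale0r subr0.
- by rewrite linear0; apply: aspan0.
- by rewrite linearB; apply: aspanB.
Qed.

Lemma iso_leq_Phi (M : {group G}) (M' : {group H}) :
  (p.-group M)%g -> (p.-group M')%g ->
  (forall a, rel_aug eG M a -> rel_aug eH M' (f a)) ->
  (forall a, rel_aug2 eH M' a -> rel_aug2 eG M (g a)) ->
  (#|M : 'Phi(M)|%g <= #|M' : 'Phi(M')|%g)%N.
Proof.
move=> pM pM' augf aug2g.
have /fin_all_exists[phi phiP] m : exists x, m \in M ->
    x \in M' /\ rel_aug2 eH M' (f (eG m - 1) - (eH x - 1)).
  have [Mm|nMm] := boolP (m \in M); last by exists 1%g.
  have /augf/rel_aug_repr[x Mx fx]: rel_aug eG M (eG m - 1).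
    by rewrite -[_ - _]mulr1; apply: rel_aug_in.
  by exists x.
pose F X := ('Phi(M') :* phi (repr X))%g.
have reprM X : X \in rcosets 'Phi(M)%g M -> repr X \in M /\ X = ('Phi(M) :* repr X)%g.
  case/rcosetsP=> x Mx ->; rewrite rcoset_repr; split=> //.
  have /rcosetP[y Py ->] := mem_repr_rcoset 'Phi(M)%G x.
  by rewrite groupM // (subsetP (Phi_sub M)).
have F_inj : {in rcosets 'Phi(M)%g M &, injective F}.
  move=> X Y /reprM[MX eX] /reprM[MY eY] /rcoset_eqP; rewrite mem_rcoset.
  have [M'X fX] := phiP _ MX; have [M'Y fY] := phiP _ MY.
  move/(Phi_rel_aug2 eH p_pr pM')/(rel_aug2_div eH M'X M'Y) => D'XY.
  have : rel_aug2 eH M' (f (eG (repr X) - eG (repr Y))).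
    have := aeqB fX fY; rewrite -rmorphB !opprB !addrA !subrK => /aspan_aeq; apply.
    exact: D'XY.
  move/aug2g; have -> : g (f (eG (repr X) - eG (repr Y))) = eG (repr X) - eG (repr Y).
    exact: fK.
  move/(rel_aug2_div eG MX MY)/(rel_aug2_Phi pM) => PXY.
  rewrite eX eY; apply/rcoset_eqP; rewrite mem_rcoset; apply: PXY.
  by rewrite groupM ?groupV.
rewrite /indexg -(card_in_imset F_inj); apply/subset_leq_card.
apply/subsetP => _ /imsetP[X /reprM[MX _] ->].
by apply/rcosetsP; exists (phi (repr X)) => //; have [] := phiP _ MX.
Qed.

End Invariants.

(** * The criterion for [z ^+ q] to lie in the third term *)

Section CriterionFails.
Variables (p : nat) (p_pr : prime p) (G : finGroupType) (A : algType 'F_p).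
Variable e : group_basis G A.
Hypothesis pG : (p.-group [set: G])%g.
Local Notation N := ([set: G]^`(1))%g.
Local Notation K := ('L_3([set: G]))%g.
Variable z : G.
Hypothesis Nz : z \in N.
Hypothesis N_gen : forall n, n \in N -> coset K n \in <[coset K z]>%g.
Variable q : nat.
Local Notation o := (#[coset K z]%g).
Hypothesis q_lt : (q < o)%N.

Let nK g : g \in 'N(K)%g.
Proof. by rewrite (subsetP (normal_norm (lcn_normal 3 _))) ?inE. Qed.

Lemma coset_derM n m : coset K (n * m)%g = (coset K n * coset K m)%g.
Proof. by rewrite morphM. Qed.

Lemma coset_derJ n g : n \in N -> coset K (n ^ g)%g = coset K n.
Proof.
move=> Nn; rewrite conjg_mulR coset_derM [X in (_ * X)%g]coset_id ?mulg1 //.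
by rewrite lcnSn mem_commg ?inE // lcn2.
Qed.

Lemma memNJ n g : (n ^ g \in N)%g = (n \in N).
Proof. by rewrite memJ_norm // (subsetP (normal_norm (der_normal 1 _))) ?inE. Qed.

Definition lg (x : coset_of K) : nat :=
  if [pick i : 'I_o | x == (coset K z ^+ i)%g] is Some i then i else 0.

Lemma lgP n : n \in N -> coset K n = (coset K z ^+ lg (coset K n))%g.
Proof.
move=> /N_gen/cyclePmin[i io ni]; rewrite /lg; case: pickP => [j /eqP//|].
by move/(_ (Ordinal io)); rewrite /= ni eqxx.
Qed.

Definition small (r : {poly 'F_p}) := 'X^(q.+1) %| r.
Local Notation "r1 =~ r2" := (small (r1 - r2)) (at level 70).

Lemma expX1_mod i j : i = j %[mod o] -> ('X + 1) ^+ i =~ ('X + 1) ^+ j.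
Proof.
have Xo : ('X + 1) ^+ o = 'X^o + 1 :> {poly 'F_p}.
  have chX : p \in [pchar {poly 'F_p}] by rewrite pchar_poly pchar_Fp.
  rewrite exprDn_pchar ?expr1n // (eq_pnat _ (pcharf_eq chX)).
  by apply: morph_p_elt => //; apply: (mem_p_elt pG); rewrite inE.
have main k : ('X + 1) ^+ k =~ ('X + 1) ^+ (k %% o).
  rewrite {1}(divn_eq k o) exprD mulnC exprM Xo /small -{2}[_ ^+ (k %% o)]mul1r -mulrBl.
  apply: dvdp_mulr; rewrite subrX1 addrK; apply: dvdp_mulr.
  exact: dvdp_exp2l.
move=> ij; rewrite /small -(subrKA (('X + 1) ^+ (i %% o))).
by apply: dvdp_add; [apply: main | rewrite ij -dvdpNr opprB; apply: main].
Qed.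

Definition Lam : {linear A -> {poly 'F_p}} :=
  gb_ext e (fun n => if n \in N then ('X + 1) ^+ lg (coset K n) else 0).

Lemma Lam_gb n : Lam (e n) = if n \in N then ('X + 1) ^+ lg (coset K n) else 0.
Proof. exact: gb_ext_gb. Qed.

Lemma dvdp_gb (d : {poly 'F_p}) (F : A -> {poly 'F_p}) :
  {morph F : a b / a - b} -> (forall g, d %| F (e g)) -> forall a, d %| F a.
Proof.
move=> FB dF a; have: aspan (fun r => d %| r) (F a).
  by apply: (aspan_gb (e := e) FB) => g; apply: aspan_in; apply: dF.
by elim=> [//||b c _ db _ dc]; [apply: dvdp0 | apply: dvdp_sub].
Qed.

Lemma Lam_mulN n a : n \in N ->
  Lam (e n * a) =~ ('X + 1) ^+ lg (coset K n) * Lam a.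
Proof.
move=> Nn; move: a; apply: dvdp_gb => [a b|g].
  by rewrite mulrBr !(linearB Lam) mulrBr !opprD !opprK addrACA.
rewrite -gbM !Lam_gb groupMl //; case: ifP => Ng; last first.
  by rewrite mulr0 subrr dvdp0.
rewrite -exprD; apply: expX1_mod; apply/eqP; rewrite -eq_expg_mod_order expgD.
by rewrite -!lgP ?groupM // coset_derM.
Qed.

Lemma Lam_commutator a b : small (Lam (a * b - b * a)).
Proof.
move: a; apply: dvdp_gb => [a c|g]; first by rewrite commrBl linearB.
move: b; apply: dvdp_gb => [a c|h]; first by rewrite commrBr linearB.
rewrite linearB -!gbM !Lam_gb /=.
have gh : (g * h = (h * g) ^ g^-1)%g by rewrite conjgE invgK !mulgA mulgK.
have -> : (g * h \in N)%g = (h * g \in N)%g.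
  by rewrite gh memNJ.
case: ifP => Nhg; last by rewrite /small subrr dvdp0.
suff -> : coset K (g * h)%g = coset K (h * g)%g by rewrite /small subrr dvdp0.
by rewrite gh coset_derJ.
Qed.

Definition degge i (S : A -> Prop) := forall s, S s -> 'X^i %| Lam s.
Definition lclosed (S : A -> Prop) := forall a s, S s -> S (a * s).

Lemma small_dvd i r : (i <= q.+1)%N -> small r -> 'X^i %| r.
Proof. by move=> iq; apply: dvdp_trans; apply: dvdp_exp2l. Qed.

Lemma dvdX_expX1 k : ('X : {poly 'F_p}) %| ('X + 1) ^+ k - 1.
Proof. by rewrite subrX1 addrK dvdp_mulr. Qed.

Lemma degge_span i S T : (forall s, S s -> 'X^i %| Lam s) ->
  (forall s, T s -> aspan S s) -> degge i T.
Proof.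
move=> dS TS s /TS; elim=> [//||b c _ db _ dc]; first by rewrite linear0 dvdp0.
by rewrite linearB; apply: dvdp_sub.
Qed.

Lemma Lam_aug i n a : n \in N -> (i <= q)%N -> 'X^i %| Lam a ->
  'X^(i.+1) %| Lam ((e n - 1) * a).
Proof.
move=> Nn iq da; rewrite mulrBl mul1r linearB /=.
pose c : {poly 'F_p} := ('X + 1) ^+ lg (coset K n).
rewrite -(subrKA (c * Lam a)); apply: dvdp_add.
  by apply: small_dvd => //; apply: Lam_mulN.
by rewrite -[X in _ - X]mul1r -mulrBl exprS dvdp_mul // dvdX_expX1.
Qed.

Lemma degge_ideal i S : (i <= q)%N -> lclosed S -> degge i S ->
  degge i.+1 (prodS (@com_ideal A) S).
Proof.
move=> iq lS dS; apply: (degge_span (T := prodS _ _)) (fun s => id).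
move=> _ [j [t [/(com_idealP e) + St ->]]].
elim=> [_ [n [g [Nn ->]]]||b c _ db _ dc].
- by rewrite -mulrA; apply: Lam_aug => //; apply/dS/lS.
- by rewrite mul0r linear0 dvdp0.
- by rewrite mulrBl linearB; apply: dvdp_sub.
Qed.

(* [[n - 1, h]] produces either a second factor from [N - 1] or a factor
   [[n, h] - 1] with [[n, h]] in [K], which [Lam] does not see. *)
Lemma degge_ideal2 i S : (i < q)%N -> lclosed S -> degge i S ->
  degge i.+2 (prodS (@com2_ideal A) S).
Proof.
move=> iq lS dS; apply: (degge_span (T := prodS _ _)) (fun s => id).
move=> _ [l [t [+ St ->]]].
elim=> [_ [c [b [+ _ ->]]]||b c _ db _ dc]; last first.
- by rewrite mulrBl linearB; apply: dvdp_sub.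
- by rewrite mul0r linear0 dvdp0.
rewrite -mulrA; move: (lS b t St); move: (b * t) => {St}t St.
elim=> [_ [j [a [+ _ ->]]]||u v _ db _ dc]; last first.
- by rewrite mulrBl linearB; apply: dvdp_sub.
- by rewrite mul0r linear0 dvdp0.
move=> Jj; move: a.
apply: (dvdp_gb (F := fun a => Lam ((j * a - a * j) * t))) => [a a'|h].
  by rewrite commrBr mulrBl linearB.
move: Jj => /(com_idealP e); elim=> [_ [n [g [Nn ->]]]||u v _ db _ dc]; last first.
- by rewrite commrBl mulrBl linearB; apply: dvdp_sub.
- by rewrite mul0r mulr0 subrr mul0r linear0 dvdp0.
pose w := [~ g^-1, h^-1]%g; pose m := (n ^ h^-1)%g.
have Nw : w \in N by rewrite derg1 mem_commg ?inE.
have Nm : m \in N by rewrite memNJ.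
have -> : ((e n - 1) * e g * e h - e h * ((e n - 1) * e g)) * t =
   (e n - 1) * ((e w - 1) * (e (h * g)%g * t)) + (e n - e m) * (e (h * g)%g * t).
  have gh : e g * e h = e w * e (h * g)%g.
    by rewrite -!gbM /w commgEl conjgE !invgK !mulgA !mulgKV.
  have hn : e h * ((e n - 1) * e g) = (e m - 1) * e (h * g)%g.
    rewrite mulrA mulrBr mulr1 -gbM !mulrBl mul1r -!gbM /m conjgE invgK.
    by rewrite !mulgA mulgKV.
  rewrite mulrBl -(mulrA _ (e g)) gh hn -!mulrA; move: (e _ * t) => u.
  rewrite (mulrBl u (e w)) mul1r (mulrBr (e n - 1)).
  rewrite -addrA; congr (_ + _); rewrite -!mulNr -mulrDl !opprB; congr (_ * _).
  by rewrite addrA subrK.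
rewrite linearD; apply: dvdp_add.
  by do 2!apply: Lam_aug => //; [exact: ltnW | apply/dS/lS].
apply: small_dvd => //; move: (e _ * t) => u.
rewrite mulrBl linearB /= /small -(subrKA (('X + 1) ^+ lg (coset K n) * Lam u)).
apply: dvdp_add; first exact: Lam_mulN.
rewrite -[coset K n](coset_derJ h^-1 Nn) -dvdpNr opprB; exact: Lam_mulN.
Qed.

Lemma degge_pow i : (i <= q)%N -> degge i (@com_pow A i).
Proof.
elim: i => [_ s _|i IHi iq]; first by rewrite expr0 dvd1p.
by apply: (degge_ideal (ltnW iq) _ (IHi (ltnW iq))) => a s; apply: com_powMl.
Qed.

Lemma degge_fil i : (i <= q)%N -> degge i.+1 (@com_fil A i).
Proof.
elim: i => [_ s Js|i IHi iq].
  have /(degge_ideal (leq0n q) (S := @setA A)) : degge 0 (@setA A).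
    by move=> t _; rewrite expr0 dvd1p.
  by apply=> //; rewrite -[s]mulr1; apply: prodS_in.
apply: (degge_span (S := fun a => prodS (@com_ideal A) (@com_fil A i) a
    \/ prodS (@com2_ideal A) (@com_pow A i) a)) => // s [].
  by apply: (degge_ideal iq _ (IHi (ltnW iq))) => a t; apply: com_filMl.
by apply: (degge_ideal2 iq _ (degge_pow (ltnW iq))) => a t; apply: com_powMl.
Qed.

Lemma lg_gen : Lam 1 =~ 1 /\ forall a, Lam ((e z - 1) * a) =~ 'X * Lam a.
Proof.
have lgE n i : n \in N -> coset K n = (coset K z ^+ i)%g ->
    ('X + 1) ^+ lg (coset K n) =~ ('X + 1) ^+ i.
  move=> Nn ni; apply: expX1_mod; apply/eqP; rewrite -eq_expg_mod_order -lgP //.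
  by rewrite ni.
split=> [|a].
  rewrite -(gb1 e) Lam_gb group1 -[X in _ - X](expr0 ('X + 1)).
  by apply: lgE; rewrite // coset_id.
rewrite mulrBl mul1r linearB /= -addrA -opprD -{1}[Lam a]mul1r -mulrDl [1 + 'X]addrC.
rewrite /small -(subrKA (('X + 1) ^+ lg (coset K z) * Lam a)).
apply: dvdp_add; first exact: Lam_mulN.
rewrite -mulrBl dvdp_mulr // -['X + 1]expr1 -{1}['X + 1]expr1.
by apply: lgE.
Qed.

Lemma com_critN : ~ com_crit A q.
Proof.
move=> crit; have [Lam1 LamX] := lg_gen.
have LamZ i : Lam ((e z - 1) ^+ i) =~ 'X^i.
  elim: i => [//|i IHi]; rewrite !exprS /small -(subrKA ('X * Lam ((e z - 1) ^+ i))).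
  by apply: dvdp_add; [apply: LamX | rewrite -mulrBr dvdp_mull].
have Jz : com_ideal (e z - 1) by apply: (der_com_ideal e).
have := com_idealX q (j := 0) (b := 1) Jz I.
rewrite addn0 mulr1 => /crit critz.
have: small (Lam ((e z - 1) ^+ q)).
  elim: critz => [a []||b c _ db _ dc].
  - elim=> [_ [b [c [_ _ ->]]]||b c _ db _ dc]; first exact: Lam_commutator.
      by rewrite linear0 /small dvdp0.
    by rewrite linearB; apply: dvdp_sub.
  - exact: degge_fil.
  - by rewrite linear0 /small dvdp0.
  - by rewrite linearB; apply: dvdp_sub.
move=> sL; have := LamZ q; rewrite /small (dvdp_subr _ sL).
by move/(dvdp_leq (monic_neq0 (monicXn _ q))); rewrite !size_polyXn ltnn.
Qed.

End CriterionFails.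

Lemma exprD1_taylor (R : comNzRingType) (u : R) n :
  exists r, (u + 1) ^+ n = 1 + u *+ n + u ^+ 2 * r.
Proof.
elim: n => [|n [r IHn]]; first by exists 0; rewrite mulr0n mulr0 !addr0.
exists (r * (u + 1) + n%:R); rewrite exprSr IHn mulrS -(mulr_natr u n).
by ring.
Qed.

Lemma deep_identity (R : comNzRingType) (u v r : R) n :
  u * (1 + (u + 1) * v) * (1 + u * v *+ n + (u * v) ^+ 2 * r) - u - u * v =
  u * (u * v) * (1 + n%:R + v * (n%:R * (u + 1) + r * (u + (u + 1) * (u * v)))).
Proof. by rewrite -(mulr_natr (u * v)); ring. Qed.

Lemma exprXD1_pow (p : nat) (p_pr : prime p) s :
  ('X + 1) ^+ (p ^ s) = 'X^(p ^ s) + 1 :> {poly 'F_p}.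
Proof.
have chX : p \in [pchar {poly 'F_p}] by rewrite pchar_poly pchar_Fp.
by rewrite exprDn_pchar ?expr1n // (eq_pnat _ (pcharf_eq chX)) pnatX pnat_id.
Qed.

Lemma expgM_central (gT : finGroupType) (x z d : gT) a :
  (z ^ x^-1 = z * d)%g -> (forall g, d * g = g * d)%g ->
  ((x * z) ^+ a = z ^+ a * d ^+ 'C(a.+1, 2) * x ^+ a)%g.
Proof.
move=> zx dC; have dXC i g : (d ^+ i * g = g * d ^+ i)%g.
  by apply/esym/commuteX; rewrite /commute dC.
have xz i : (x ^+ i * z = z * d ^+ i * x ^+ i)%g.
  elim: i => [|i IHi]; first by rewrite !mul1g !mulg1.
  have -> : (x ^+ i.+1 * z = (x ^+ i * z) * (d * x))%g.
    by rewrite expgSr -!mulgA (conjgCV x z) zx !mulgA.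
  rewrite IHi (expgSr d) (expgSr x) -!mulgA; do 2!congr (_ * _)%g.
  by rewrite !mulgA dC.
elim: a => [|a IHa]; first by rewrite !mulg1.
rewrite expgSr IHa; have := xz 1%N; rewrite !expg1 => ->.
rewrite (binS a.+1) bin1; move: 'C(a.+1, 2) => b.
rewrite (expgSr z) (expgSr x) expgD (expgSr d) -!mulgA; congr (_ * _)%g.
rewrite (mulgA (x ^+ a)%g z) xz -!mulgA (mulgA (d ^+ b)%g z) dXC -!mulgA.
by do 3!congr (_ * _)%g; rewrite !mulgA dC.
Qed.

Section Groups.
Variables (p : nat) (G : finGroupType).
Local Notation N := ([set: G]^`(1))%g.
Local Notation K := ('L_3([set: G]))%g.

Lemma mem_L3R n g : n \in N -> [~ n, g]%g \in K.
Proof. by move=> Nn; rewrite lcnSn mem_commg ?inE // lcn2. Qed.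

Hypotheses (p_pr : prime p) (p_odd : odd p).
Hypothesis KZ : (K \subset 'Z([set: G]))%g.
Hypothesis Kp : forall c, c \in K -> (c ^+ p = 1)%g.

Lemma L3C c g : c \in K -> (c * g = g * c)%g.
Proof. by move/(subsetP KZ)/centerP => [_ /(_ g)]; apply; rewrite inE. Qed.

Lemma pow_conj_gen x y a : exists2 c, c \in K &
  ((x ^+ a) ^ y = [~ x, y] ^+ a * c * x ^+ a)%g /\ ((p %| a)%N -> c = 1%g).
Proof.
have Kd : [~ [~ x, y], x^-1]%g \in K by apply: mem_L3R; rewrite derg1 mem_commg ?inE.
exists ([~ [~ x, y], x^-1] ^+ 'C(a.+1, 2))%g; first exact: groupX.
split.
  rewrite conjXg conjg_mulR; apply: expgM_central; first exact: conjg_mulR.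
  by move=> g; apply: L3C.
move=> pa; have: (p %| 2 * 'C(a.+1, 2))%N.
  by rewrite -mul_bin_diag bin1 dvdn_mull.
rewrite Euclid_dvdM // dvdn_prime2 // => /orP[/eqP p2|/dvdnP[k ->]].
  by move: p_odd; rewrite p2.
by rewrite mulnC expgM Kp // expg1n.
Qed.

End Groups.

Section CriterionHolds.
Variables (p : nat) (p_pr : prime p) (G : finGroupType) (A : algType 'F_p).
Variable e : group_basis G A.
Hypothesis p_odd : odd p.
Local Notation N := ([set: G]^`(1))%g.
Local Notation K := ('L_3([set: G]))%g.
Hypothesis KZ : (K \subset 'Z([set: G]))%g.
Hypothesis Kp : forall c, c \in K -> (c ^+ p = 1)%g.
Variables (x y : G) (k : nat).
Hypothesis k_gt0 : (0 < k)%N.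
Local Notation q := (p ^ k)%N.
Local Notation z := ([~ x, y]%g).
Hypothesis zy : ([~ z, y] = z ^+ q)%g.
Hypothesis N_gen : forall n, n \in N -> exists i c, c \in K /\ (n = z ^+ i * c)%g.
Hypothesis G_gen : forall g, exists a b n, n \in N /\ (g = n * (x ^+ a * y ^+ b))%g.

Local Notation Z := (e z - 1).
Local Notation X := (sumS (commS (@setA A) (@setA A)) (@com_fil A q)).

Let Nz : z \in N. Proof. by rewrite derg1 mem_commg ?inE. Qed.
Let JZ : com_ideal Z. Proof. exact: (der_com_ideal e). Qed.

Lemma der3_com2 c : c \in K -> com2_ideal (e c - 1).
Proof.
rewrite lcnSn lcn2 /commutator; move: c; apply: gen_ind => [|c d Jc Jd|_ /imset2P[n g Nn _ ->]].
- by rewrite gb1 subrr; apply: aspan0.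
- have ->: e (c * d)%g - 1 = (e c - 1) * e d + (e d - 1).
    by rewrite gbM mulrBl mul1r addrA subrK.
  by apply: aspanD => //; apply: prodSMr Jc.
have ->: e [~ n, g]%g - 1 = e (n^-1 * g^-1)%g * (((e n - 1) * e g - e g * (e n - 1)) * 1).
  have ->: (e n - 1) * e g - e g * (e n - 1) = e n * e g - e g * e n.
    by rewrite mulrBl mulrBr mul1r mulr1 opprB addrA subrK.
  rewrite mulr1 mulrBr -!(gbM e).
  by rewrite commgEl conjgE !mulgA mulgKV mulVg (gb1 e).
apply/com2_idealMl/prodS_in/I/commS_in/I; exact: (der_com_ideal e).
Qed.

Local Notation phi := (horner_alg (A:=A) Z).
Let W : phi ('X + 1) = e z.
Proof. by rewrite rmorphD rmorph1 /= horner_algX subrK. Qed.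
Let phiX m : phi 'X^m = Z ^+ m.
Proof. by rewrite rmorphXn /= horner_algX. Qed.
Let phiXM m r b : (q < m)%N -> com_fil q (phi ('X^m * r) * b).
Proof. by move=> qm; rewrite rmorphM /= phiX -mulrA; apply: com_fil_expr. Qed.

Lemma com_ideal_mod j : com_ideal j -> exists u, com2_ideal (j - Z * u).
Proof.
move/(com_idealP e); elim=> [_ [n [g [Nn ->]]]||b c _ [u bu] _ [v cv]]; last first.
- by exists (u - v); have := aspanB bu cv; rewrite mulrBr !opprD !opprK addrACA.
- by exists 0; rewrite mulr0 subr0; apply: aspan0.
have [i [c [Kc ->]]] := N_gen Nn.
exists (\sum_(j < i) e z ^+ j * e g).
rewrite -mulr_suml mulrA -subrX1 -mulrBl; apply: prodSMr => //.
have ->: e (z ^+ i * c)%g - 1 - (e z ^+ i - 1) = e z ^+ i * (e c - 1).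
  by rewrite opprB addrA subrK gbM gbX mulrBr mulr1.
exact/com2_idealMl/der3_com2.
Qed.

Lemma com_pow_mod i s : com_pow i s -> exists u, com_fil i (s - Z ^+ i * u).
Proof.
elim: i s => [|i IHi] s; first by exists s; rewrite mul1r subrr; apply: aspan0.
elim=> [_ [j [t [Jj Pt ->]]]||b c _ [u bu] _ [v cv]]; last first.
- by exists (u - v); have := aspanB bu cv; rewrite mulrBr !opprD !opprK addrACA.
- by exists 0; rewrite mulr0 subr0; apply: aspan0.
have [u ju] := com_ideal_mod Jj; have [v uv] := IHi _ (com_powMl u Pt).
exists v.
have -> : j * t - Z ^+ i.+1 * v = (j - Z * u) * t + Z * (u * t - Z ^+ i * v).
  by rewrite mulrBl mulrBr exprS !mulrA addrA subrK.
by apply: aspanD; [apply/sumSr/prodS_in | apply/com_filS].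
Qed.

Definition conj_poly : {poly 'F_p} := 'X * (1 + ('X + 1) * 'X^(q.-1)).

Lemma conj_Z m : e y^-1%g * Z ^+ m * e y = phi (conj_poly ^+ m).
Proof.
have eyV : e y * e y^-1%g = 1 by rewrite -gbM mulgV gb1.
have q_gt0 : (0 < q)%N by rewrite expn_gt0 prime_gt0.
have Z1 : e y^-1%g * Z * e y = phi conj_poly.
  have -> : conj_poly = ('X + 1) ^+ q.+1 - 1.
    rewrite exprSr exprXD1_pow // /conj_poly mulrDr mulr1 mulrCA -exprS prednK //.
    by ring.
  rewrite rmorphB rmorph1 rmorphXn /= W -gbX mulrBr mulrBl mulr1 -!gbM mulVg gb1.
  by rewrite -mulgA -conjgE conjg_mulR zy -expgS.
elim: m => [|m IHm]; first by rewrite !expr0 mulr1 -gbM mulVg gb1 rmorph1.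
rewrite !exprSr rmorphM /= -IHm -Z1.
by rewrite -!mulrA (mulrA (e y)) eyV mul1r.
Qed.

Lemma conj_poly_mod m : exists r, conj_poly ^+ m = 'X^m + 'X^(m + q.-1) * r.
Proof.
have [r Er] := exprD1_taylor (('X + 1) * 'X^(q.-1) : {poly 'F_p}) m.
exists (('X + 1) *+ m + ('X + 1) ^+ 2 * 'X^(q.-1) * r).
rewrite /conj_poly [1 + _]addrC exprMn Er exprD -(mulr_natr _ m) -(mulr_natr ('X + 1) m).
by ring.
Qed.

Lemma conj_commS m g w : (g ^ y = w * g)%g ->
  X (phi (conj_poly ^+ m) * (e w * e g) - Z ^+ m * e g).
Proof.
move=> gy; apply/sumSl.
have -> : phi (conj_poly ^+ m) * (e w * e g) - Z ^+ m * e g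
    = e y^-1%g * (Z ^+ m * e g * e y) - (Z ^+ m * e g * e y) * e y^-1%g.
  have ewg : e w * e g = e y^-1%g * (e g * e y) by rewrite -!gbM -gy conjgE.
  have eyV : e y * e y^-1%g = 1 by rewrite -gbM mulgV gb1.
  rewrite -(conj_Z m) ewg -!mulrA (mulrA (e y) (e y^-1)%g) eyV mul1r.
  by rewrite mulr1.
exact: commS_in.
Qed.

Lemma com_crit_shallow s a c g : (p ^ s < q)%N -> ~~ (p %| a)%N -> c \in K ->
  (s = 0%N \/ c = 1%g) -> (g ^ y = z ^+ (p ^ s * a) * c * g)%g ->
  X (Z ^+ q * e g).
Proof.
move=> sq pa Kc sc gy; pose m := (q - p ^ s)%N.
have qE : q = (m + p ^ s)%N by rewrite subnK // ltnW.
have m_ge2 : (2 <= m)%N.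
  have p_gt2 : (2 < p)%N by rewrite odd_prime_gt2.
  have sk : (s < k)%N by rewrite -(ltn_exp2l _ _ (prime_gt1 p_pr)).
  have: (p ^ s * 3 <= q)%N.
    apply: leq_trans (leq_pexp2l (prime_gt0 p_pr) sk); rewrite expnSr.
    by rewrite leq_mul2l p_gt2 orbT.
  have: (0 < p ^ s)%N by rewrite expn_gt0 prime_gt0.
  by rewrite /m; lia.
pose w := (z ^+ (p ^ s * a) * c)%g; pose t := e w * e g.
have [r1 Er1] := conj_poly_mod m.
have [r2 Er2] := exprD1_taylor ('X^(p ^ s) : {poly 'F_p}) a.
have ewE : e w = phi (('X + 1) ^+ (p ^ s * a)) * e c.
  by rewrite gbM gbX rmorphXn /= W.
have sub_t : X (Z ^+ m * t - Z ^+ m * e g).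
  have := conj_commS m gy; rewrite -/w -/t Er1 rmorphD /= phiX mulrDl => Xt.
  have Xr : X (phi ('X^(m + q.-1) * r1) * t) by apply/sumSr/phiXM; lia.
  by have := aspanB Xt Xr; rewrite addrAC addrK.
have sub_w : X (phi ('X^m * ('X + 1) ^+ (p ^ s * a)) * e g - Z ^+ m * e g).
  have Kt : X (Z ^+ m * ((phi (('X + 1) ^+ (p ^ s * a)) * (e c - 1)) * e g)).
    apply: sumSr; case: sc => [s0|->]; last first.
      by rewrite gb1 subrr mulr0 mul0r mulr0; apply: com_fil0.
    have -> : com_fil q = @com_fil A m.+1 by rewrite qE s0 addn1.
    by apply: com2_fil => //; exact/com2_idealMl/der3_com2.
  have := aspanB sub_t Kt; congr (aspan _ _); rewrite /t ewE rmorphM /= phiX.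
  by rewrite mulrBr mulr1 mulrBl mulrBr !mulrA opprB addrC addrA subrK.
have main : X (phi ('X^q *+ a) * e g).
  have Kr : X (phi ('X^(q + p ^ s) * r2) * e g).
    by apply/sumSr/phiXM; rewrite -addn1 leq_add2l expn_gt0 prime_gt0.
  have := aspanB sub_w Kr; congr (aspan _ _); rewrite -phiX -!mulrBl -!rmorphB.
  congr (phi _ * _); rewrite exprM exprXD1_pow // Er2.
  have -> : 'X^q = 'X^m * 'X^(p ^ s) :> {poly 'F_p} by rewrite -exprD -qE.
  have -> : 'X^(q + p ^ s) = 'X^m * 'X^(p ^ s) ^+ 2 :> {poly 'F_p}.
    by rewrite -exprM mulnC mul2n -addnn -exprD addnA -qE.
  by rewrite !mulrDr mulr1 (mulrA _ _ r2) addrAC addrK addrAC subrr add0r mulrnAr.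
have := aspanZ (a%:R^-1 : 'F_p) main; congr (aspan _ _).
rewrite raddfMn /= phiX mulrnAl -scaler_nat scalerA mulVf ?scale1r //.
by rewrite -(dvdn_pcharf (pchar_Fp p_pr)).
Qed.

Lemma com_crit_deep a g :
  (q %| a)%N -> (g ^ y = z ^+ a * g)%g -> X (Z ^+ q * e g).
Proof.
case/dvdnP=> a' -> gy.
have [r Er] := exprD1_taylor ('X^q : {poly 'F_p}) a'.
have q_gt0 : (0 < q)%N by rewrite expn_gt0 prime_gt0.
pose P : {poly 'F_p} := conj_poly * ('X + 1) ^+ (a' * q) - 'X - 'X^q.
have [r' PE] : exists r', P = 'X^(q.+1) * r'.
  exists (1 + a'%:R + 'X^(q.-1) * (a'%:R * ('X + 1) + r * ('X + ('X + 1) * 'X^q))).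
  have qS : 'X^q = 'X * 'X^(q.-1) :> {poly 'F_p} by rewrite -exprS prednK.
  rewrite /P mulnC exprM exprXD1_pow // Er /conj_poly (exprS _ q) qS.
  exact: deep_identity.
have -> : Z ^+ q * e g =
    (phi (conj_poly ^+ 1) * (e (z ^+ (a' * q))%g * e g) - Z ^+ 1 * e g) - phi P * e g.
  have -> : e (z ^+ (a' * q))%g = phi (('X + 1) ^+ (a' * q)).
    by rewrite gbX rmorphXn /= W.
  rewrite mulrA -!phiX -rmorphM -!mulrBl -!rmorphB; congr (phi _ * _).
  by rewrite /P !expr1 subKr.
apply: aspanB; first exact: conj_commS.
by apply: sumSr; rewrite PE; apply: phiXM.
Qed.

Lemma com_critP : com_crit A q.
Proof.
move=> a /com_pow_mod[u au]; rewrite -[a](subrK (Z ^+ q * u)).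
apply: aspanD; first exact: sumSr.
move: u {au}; apply: (aspan_gb (e := e)) => [b c|g]; first by rewrite mulrBr.
have [i [j [n [Nn ->]]]] := G_gen g; set h := (x ^+ i * y ^+ j)%g.
have -> : Z ^+ q * e (n * h)%g = Z ^+ q * e h + Z ^+ q * ((e n - 1) * e h).
  by rewrite (gbM e n h) -mulrDr mulrBl mul1r [e h + _]addrC subrK.
apply: aspanD; last first.
  apply/sumSr/com_pow_fil; rewrite -[q.+1]addn1; apply: com_idealX => //.
  by apply: prodS_in => //; apply: der_com_ideal.
have [c Kc [cE c1]] := pow_conj_gen p_pr p_odd KZ Kp x y i.
have hy : (h ^ y = z ^+ i * c * h)%g.
  by rewrite conjMg cE conjXg [(y ^ y)%g]conjgE mulKg !mulgA.
have [qi|nqi] := boolP (q %| i)%N.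
  apply: (com_crit_deep qi); rewrite hy c1 ?mulg1 //.
  by apply: dvdn_trans qi; apply: dvdn_exp.
have i_gt0 : (0 < i)%N by case: (i) nqi; rewrite ?dvdn0.
have [i' co_i' iE] := pfactor_coprime p_pr i_gt0; set s := logn p i in iE.
have sk : (s < k)%N.
  rewrite ltnNge; apply: contra nqi => ks; rewrite iE dvdn_mull //.
  exact: dvdn_exp2l.
apply: (com_crit_shallow (s := s) (a := i') _ _ Kc).
- by rewrite ltn_exp2l ?prime_gt1.
- by rewrite -prime_coprime.
- case: (s) iE => [|s'] iE; [by left | right; apply: c1].
  by rewrite iE dvdn_mull // dvdn_exp.
- by rewrite mulnC -iE.
Qed.

End CriterionHolds.

(** * Two-generated groups with central third term *)

Section TwoGenerated.
Local Open Scope group_scope.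
Variables (G : finGroupType) (x y : G).
Hypothesis gen_xy : <<[set x; y]>> = [set: G].
Local Notation N := [set: G]^`(1).
Local Notation K := 'L_3([set: G]).

Lemma two_gen_coords g : exists a b n, n \in N /\ g = n * (x ^+ a * y ^+ b).
Proof.
have nN h : h \in 'N(N) by rewrite (subsetP (normal_norm (der_normal 1 _))) ?inE.
have cNN (h k : G) : commute (coset N h) (coset N k).
  have abGN : abelian ([set: G] / N) by apply: sub_der1_abelian.
  by apply: (centsP abGN); apply: mem_quotient; rewrite inE.
suff [a [b gE]]: exists a b, coset N g = coset N x ^+ a * coset N y ^+ b.
  exists a, b, (g * (x ^+ a * y ^+ b)^-1); rewrite mulgKV; split=> //.
  rewrite -mem_rcoset; apply/rcoset_kercosetP => //.
  by rewrite gE morphM ?morphX ?groupX.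
have: g \in <<[set x; y]>> by rewrite gen_xy inE.
move: g; apply: gen_ind => [|g h [a [b gE]] [c [d hE]]|g].
- by exists 0, 0; rewrite mulg1 coset_id.
- exists (a + c)%N, (b + d)%N.
  have -> : coset N (g * h) = coset N g * coset N h by exact: morphM.
  rewrite gE hE !expgD !mulgA.
  congr (_ * _); rewrite -!mulgA; congr (_ * _).
  by apply/commuteX2/cNN.
case/set2P=> ->; first by exists 1%N, 0; rewrite mulg1.
by exists 0, 1%N; rewrite mul1g.
Qed.

Lemma two_gen_der n : n \in N -> exists i c, c \in K /\ n = [~ x, y] ^+ i * c.
Proof.
set z := [~ x, y]; have Nz : z \in N by rewrite derg1 mem_commg ?inE.
have nK h : h \in 'N(K) by rewrite (subsetP (normal_norm (lcn_normal 3 _))) ?inE.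
have nKM : <[z]> \subset 'N(K) by apply/subsetP=> h _.
suff /subsetP sNM : N \subset <[z]> <*> K.
  move/sNM; rewrite norm_joinEl // => /mulsgP[_ c /cycleP[i ->] Kc ->].
  by exists i, c.
have sMN : <[z]> <*> K \subset N.
  by rewrite join_subG cycle_subG /= Nz -lcn2 lcn_subS.
have nM : [set: G] \subset 'N(<[z]> <*> K).
  rewrite -commg_subl; apply: subset_trans (commSg _ sMN) _.
  by rewrite -lcn2 -lcnSn joing_subr.
apply: (der1_min nM).
have -> : [set: G] / (<[z]> <*> K) = <<[set x; y] / (<[z]> <*> K)>>.
  by rewrite -quotient_gen ?gen_xy // (subset_trans (subsetT _) nM).
rewrite abelian_gen.
apply: quotient_cents2r; rewrite gen_subG; apply/subsetP => _ /imset2P[u v + + ->].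
have Mz : z \in <[z]> <*> K by rewrite mem_gen // inE cycle_id.
by case/set2P=> ->; case/set2P=> ->; rewrite ?commgg ?group1 // -invg_comm groupV.
Qed.

End TwoGenerated.

Section ClassThree.
Local Open Scope group_scope.
Variables (p : nat) (G : finGroupType).
Hypotheses (p_pr : prime p) (p_odd : odd p) (pG : p.-group [set: G]).
Local Notation N := [set: G]^`(1).
Local Notation K := 'L_3([set: G]).
Hypothesis KZ : K \subset 'Z([set: G]).
Hypothesis Kp : forall c, c \in K -> c ^+ p = 1.
Hypothesis K1 : K != 1.
Variables (x y : G).
Hypothesis gen_xy : <<[set x; y]>> = [set: G].
Local Notation z := [~ x, y].

Let KC c g : c \in K -> commute c g.
Proof. by move=> Kc; apply: L3C. Qed.

Let Nz : z \in N. Proof. by rewrite derg1 mem_commg ?inE. Qed.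

Let KRz n g : n \in N -> commute n [~ n, g].
Proof. by move=> Nn; apply/commute_sym/KC/mem_L3R. Qed.

Let sKN : K \subset N.
Proof. by rewrite -lcn2 lcn_subS. Qed.

Lemma der_prod : N = <[z]> * K.
Proof.
apply/eqP; rewrite eqEsubset mul_subG ?cycle_subG // andbT.
apply/subsetP => n /(two_gen_der gen_xy)[i [c [Kc ->]]].
by rewrite mem_mulg ?mem_cycle.
Qed.

Let sK_Zcap : K \subset 'Z([set: G]) :&: N.
Proof. by rewrite subsetI KZ. Qed.

Lemma gen_notin_L3 : z \notin K.
Proof.
apply: contra K1 => Kz; apply/eqP; rewrite lcnSn lcn2; apply/commG1P.
apply: subset_trans (subset_trans _ KZ) (subsetIr _ _).
by rewrite der_prod mul_subG ?cycle_subG.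
Qed.

Lemma der_abelian : abelian N.
Proof.
rewrite der_prod abelianM cycle_abelian (abelianS KZ) ?center_abelian //=.
by apply/centsP => c Kc w _; apply: KC.
Qed.

Lemma commg_pow_p g : g \in N -> forall h, commute (g ^+ p) h.
Proof.
by move=> Ng h; apply/commgP; rewrite commXg ?Kp ?mem_L3R //; apply: KRz.
Qed.

Lemma index_center_der : #|N : 'Z([set: G]) :&: N| = p.
Proof.
pose C := ('Z([set: G]) :&: N)%G.
have nC h : h \in 'N(C).
  have: C <| [set: G] by rewrite normalI ?center_normal ?der_normal.
  by move/normal_norm/subsetP; apply; rewrite inE.
rewrite -card_quotient; last by apply/subsetP=> h _; apply: nC.
have -> : N / C = <[coset C z]>.
  rewrite -quotient_cycle //; apply/eqP; rewrite eqEsubset andbC.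
  rewrite [X in X && _]quotientS ?cycle_subG //=.
  rewrite -(quotientMidr C <[z]>) quotientS // {1}der_prod; exact: mulgS.
apply: nt_prime_order => //.
  rewrite -morphX //; apply: coset_id; apply/setIP; split; last exact: groupX.
  by apply/centerP; split=> [|h _]; [rewrite inE | apply: commg_pow_p].
apply/eqP => Cz1.
have /setIP[Zz _] : z \in C by apply: coset_idr.
case/negP: K1; apply/eqP; rewrite lcnSn lcn2; apply/commG1P.
apply: subset_trans _ (subsetIr [set: G] _); rewrite der_prod mul_subG //.
by rewrite cycle_subG.
Qed.

Lemma Phi_der : 'Phi(N) = <[z ^+ p]>.
Proof.
have pN : p.-group N by apply: pgroupS pG; apply: subsetT.
rewrite (Phi_Mho pN der_abelian) (MhoEabelian _ pN der_abelian) expn1.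
apply/setP=> w; apply/imsetP/cycleP => [[n Nn ->]|[i ->]].
  have [i [c [Kc ->]]] := two_gen_der gen_xy Nn; exists i.
  rewrite expgMn; last exact/commute_sym/KC.
  by rewrite (Kp Kc) mulg1 -!expgM mulnC.
by exists (z ^+ i); rewrite ?groupX // -!expgM mulnC.
Qed.

Lemma order_gen : #[z] = (p * #|'Phi(N)|)%N.
Proof.
have pz : p.-elt z by apply: (mem_p_elt pG); rewrite inE.
have z1 : z != 1 by apply: contraNneq gen_notin_L3 => ->; rewrite group1.
have pd : (p %| #[z])%N.
  have /p_natP[[|k] zk] := pz; first by move: z1; rewrite -order_eq1 zk.
  by rewrite zk expnS dvdn_mulr.
by rewrite Phi_der -orderE orderXdiv // mulnC divnK.
Qed.

Lemma exp_p_cap q c : #[z] = (p * q)%N -> c \in <[z]> :&: K -> c \in <[z ^+ q]>.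
Proof.
move=> zq /setIP[/cycleP[i ->] Ki].
have: (#[z] %| i * p)%N by rewrite order_dvdn expgM Kp.
rewrite zq mulnC dvdn_pmul2r ?prime_gt0 // => /dvdnP[j ->].
by rewrite mulnC expgM mem_cycle.
Qed.

Lemma card_cap q : #[z] = (p * q)%N ->
  #|<[z]> :&: K| = if z ^+ q \in K then p else 1%N.
Proof.
move=> zq; have q_gt0 : (0 < q)%N.
  by have := order_gt0 z; rewrite zq muln_gt0 => /andP[].
have oq : #[z ^+ q] = p by rewrite orderXdiv zq ?dvdn_mull // mulnK.
have sub : <[z]> :&: K \subset <[z ^+ q]> by apply/subsetP => c; apply: exp_p_cap.
case: ifP => [Kzq|nKzq].
  rewrite -oq orderE; congr #|pred_of_set _|; apply/eqP; rewrite eqEsubset sub /=.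
  by rewrite cycle_subG inE mem_cycle.
apply/eqP; rewrite -trivg_card1; apply: contraFT nKzq => ntI.
have : <[z ^+ q]> \subset <[z]> :&: K.
  apply: prime_meetG; first by rewrite -orderE oq.
  by rewrite (setIidPr sub).
by rewrite cycle_subG inE => /andP[].
Qed.

Lemma commg_genM h k : [~ z, h * k] = [~ z, h] * [~ z, k].
Proof.
by rewrite commgMJ (KC _ (mem_L3R k Nz)) /conjg (KC k (mem_L3R h Nz)) mulKg.
Qed.

Lemma commg_genX h i : [~ z, h ^+ i] = [~ z, h] ^+ i.
Proof. by elim: i => [|i IHi]; rewrite ?commg1 // expgSr commg_genM IHi expgSr. Qed.

Lemma commg_der i c h : c \in K -> [~ z ^+ i * c, h] = [~ z, h] ^+ i.
Proof.
move=> Kc; rewrite commMgJ; have /commgP/eqP-> := KC h Kc.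
rewrite mulg1 commXg; last exact: KRz.
by rewrite /conjg (KC c (groupX i (mem_L3R h Nz))) mulKg.
Qed.

Lemma commg_onto c : c \in K -> exists h, c = [~ z, h].
Proof.
rewrite {1}lcnSn lcn2 /commutator; move: c.
apply: gen_ind => [|_ _ [g ->] [h ->]|_ /imset2P[n h Nn _ ->]].
- by exists 1; rewrite commg1.
- by exists (g * h); rewrite commg_genM.
have [i [c [Kc ->]]] := two_gen_der gen_xy Nn; exists (h ^+ i).
by rewrite commg_genX commg_der.
Qed.

Lemma exchange_gen q : #[z] = (p * q)%N -> (p %| q)%N -> z ^+ q \in K ->
  exists x' y', <<[set x'; y']>> = [set: G] /\ [~ [~ x', y'], y'] = [~ x', y'] ^+ q.
Proof.
move=> zq pq Kzq; have [h zh] := commg_onto Kzq.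
have q_gt0 : (0 < q)%N.
  by have := order_gt0 z; rewrite zq muln_gt0 => /andP[].
suff [x' gen_x'h] : exists x', <<[set x'; h]>> = [set: G].
  exists x', h; split=> //.
  have Nx' : [~ x', h] \in N by rewrite derg1 mem_commg ?inE.
  have [i [c [Kc ->]]] := two_gen_der gen_xy Nx'.
  rewrite commg_der // -zh.
  rewrite (expgMn _ (commute_sym (KC (z ^+ i) Kc))).
  by case/dvdnP: pq => j ->; rewrite (mulnC j) [c ^+ _]expgM Kp // expg1n mulg1 -!expgM mulnC.
have [a [b [n [Nn hE]]]] := two_gen_coords gen_xy h.
have sNPhi : N \subset 'Phi([set: G]) by rewrite (Phi_joing pG) joing_subl.
have gen_of x' : x \in 'Phi([set: G]) <*> [set x'; h] ->
    y \in 'Phi([set: G]) <*> [set x'; h] -> <<[set x'; h]>> = [set: G].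
  move=> Mx My; apply: Phi_nongen; apply/eqP; rewrite eqEsubset subsetT /=.
  have : <<[set x; y]>> \subset 'Phi([set: G]) <*> [set x'; h].
    by rewrite gen_subG; apply/subsetP => g /set2P[] ->.
  by rewrite gen_xy.
have Xp (u : G) i (M : {group G}) : coprime p i -> u ^+ i \in M -> u \in M.
  move=> co_pi; rewrite -!cycle_subG => uM.
  have /p_natP[j uj] : p.-elt u by apply: (mem_p_elt pG); rewrite inE.
  have : generator <[u]> (u ^+ i) by rewrite generator_coprime uj; apply: coprimeXl.
  by move/eqP->.
have nPhi x' m : m \in N -> m \in 'Phi([set: G]) <*> [set x'; h].
  by move=> Nm; rewrite mem_gen // inE (subsetP sNPhi).
have inM x' g : g \in [set x'; h] -> g \in 'Phi([set: G]) <*> [set x'; h].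
  by move=> gx; rewrite mem_gen // inE gx orbT.
have [pb|npb] := boolP (p %| b)%N; last first.
  exists x; apply: gen_of; first by rewrite inM ?set21.
  apply: (Xp _ b); first by rewrite prime_coprime.
  have -> : y ^+ b = (n * x ^+ a)^-1 * h by rewrite hE (mulgA n) mulKg.
  apply: groupM; last by rewrite inM ?set22.
  by rewrite groupV; apply: groupM; [apply: nPhi | rewrite groupX ?inM ?set21].
have [pa|npa] := boolP (p %| a)%N; last first.
  exists y; apply: gen_of; last by rewrite inM ?set21.
  apply: (Xp _ a); first by rewrite prime_coprime.
  have -> : x ^+ a = n^-1 * h * (y ^+ b)^-1 by rewrite hE !mulgA mulgK mulVg mul1g.
  apply: groupM; last by rewrite groupV groupX ?inM ?set21.
  by apply: groupM; [rewrite groupV nPhi | rewrite inM ?set22].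
have zX u i : (p %| i)%N -> [~ z, u ^+ i] = 1.
  case/dvdnP=> j ->; rewrite mulnC expgM !commg_genX Kp ?expg1n //.
  exact: mem_L3R.
have zn : [~ z, n] = 1.
  by apply/eqP/commgP; apply: (centsP der_abelian).
have /eqP : z ^+ q = 1 by rewrite zh hE !commg_genM zn !zX ?mulg1.
rewrite -order_dvdn zq => /(dvdn_leq q_gt0).
by rewrite -{2}[q]mul1n leq_pmul2r // leqNgt prime_gt1.
Qed.

Variables (A : algType 'F_p) (e : group_basis G A).

Lemma com_crit_iff q : #[z] = (p * q)%N -> com_crit A q <-> z ^+ q \in K.
Proof.
move=> zq; have nK h : h \in 'N(K).
  by rewrite (subsetP (normal_norm (lcn_normal 3 _))) ?inE.
have pz : p.-elt z by apply: (mem_p_elt pG); rewrite inE.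
have /p_natP[k qk] : p.-nat q by apply: pnat_dvd pz; rewrite zq dvdn_mull.
split=> [crit|Kzq].
  apply/idPn => nKzq; move: crit; apply: (com_critN p_pr e pG Nz) => [n Nn|].
    have [i [c [Kc ->]]] := two_gen_der gen_xy Nn.
    by rewrite morphM // [X in _ * X]coset_id // mulg1 morphX // mem_cycle.
  have /p_natP[t ct] : p.-elt (coset K z) by apply: morph_p_elt.
  rewrite ct qk ltn_exp2l ?prime_gt1 // ltnNge; apply: contra nKzq => tk.
  apply: coset_idr; first exact: groupX.
  by rewrite morphX //; apply/eqP; rewrite -order_dvdn ct qk dvdn_exp2l.
have k_gt0 : (0 < k)%N.
  by case: k qk => // q1; case/negP: gen_notin_L3; move: Kzq; rewrite q1 expn0 expg1.
have pq : (p %| q)%N by rewrite qk dvdn_exp.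
have [x' [y' [gen' zy']]] := exchange_gen zq pq Kzq.
rewrite qk in zy' *; apply: (com_critP p_pr e p_odd KZ Kp k_gt0 zy').
  exact: two_gen_der.
exact: two_gen_coords.
Qed.

End ClassThree.

Section Frattini.
Local Open Scope group_scope.
Variables (p : nat) (G : finGroupType).
Hypotheses (p_pr : prime p) (pG : p.-group [set: G]).
Local Notation Phi := 'Phi([set: G]).

Let nPhi g : g \in 'N(Phi).
Proof. by rewrite (subsetP (normal_norm (Phi_normal _))) ?inE. Qed.

Let card_Phi : #|[set: G] : Phi| = (p ^ 'm([set: G] / Phi))%N.
Proof.
have abQ := Phi_quotient_abelem pG.
rewrite -card_quotient ?normal_norm ?Phi_normal //.
rewrite grank_abelian ?(abelem_abelian abQ) // (rank_abelem abQ).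
by rewrite -card_pgroup ?(abelem_pgroup abQ).
Qed.

Lemma two_gen_index_Phi x y : <<[set x; y]>> = [set: G] ->
  (#|[set: G] : Phi| <= p ^ 2)%N.
Proof.
move=> gen; rewrite card_Phi leq_exp2l ?prime_gt1 //.
apply: leq_trans (quotient_grank _) _; first exact/normal_norm/Phi_normal.
rewrite /= -gen; apply: leq_trans (grank_min _) _.
by rewrite cards2; case: eqP.
Qed.

Lemma index_Phi_two_gen : (#|[set: G] : Phi| <= p ^ 2)%N ->
  exists x y, <<[set x; y]>> = [set: G].
Proof.
rewrite card_Phi leq_exp2l ?prime_gt1 // => m2.
have [B genB cardB] := grank_witness ([set: G] / Phi).
have lift i : exists x, coset Phi x = nth 1 (enum B) i.
  by have [x _ ->] := cosetP (nth 1 (enum B) i); exists x.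
have [[x xE] [y yE]] := (lift 0%N, lift 1%N); exists x, y.
apply: Phi_nongen; apply/eqP; rewrite eqEsubset subsetT /=.
apply/subsetP => g _.
have : coset Phi g \in <<B>> by rewrite genB mem_quotient ?inE.
have sB : B \subset <<[set x; y]>> / Phi.
  apply/subsetP => b; rewrite -mem_enum => /(nthP (1 : coset_of Phi))[i].
  rewrite -cardE cardB => im <-.
  have: (i < 2)%N by apply: leq_trans m2.
  case: i {im} => [|[|//]] _; rewrite -?xE -?yE mem_quotient ?mem_gen ?set21 ?set22 //.
rewrite -gen_subG in sB; move/(subsetP sB)/morphimP => [m _ Mm /esym gm].
have : g \in Phi :* m by apply/rcoset_kercosetP.
have sM : <<[set x; y]>> \subset Phi <*> [set x; y] by apply/genS/subsetUr.
case/rcosetP => f Pf ->; apply: groupM; last exact: (subsetP sM).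
by rewrite mem_gen // inE Pf.
Qed.

End Frattini.

Section Converse.
Local Open Scope group_scope.
Variables (p : nat) (G : finGroupType).
Hypotheses (p_pr : prime p) (pG : p.-group [set: G]).
Local Notation N := [set: G]^`(1).
Local Notation K := 'L_3([set: G]).
Hypothesis indexN : #|N : 'Z([set: G]) :&: N| = p.

Let C := ('Z([set: G]) :&: N)%G.

Let nC : C <| [set: G].
Proof. by rewrite normalI ?center_normal ?der_normal. Qed.

Let card_NC : #|N / C| = p.
Proof. by rewrite card_quotient ?indexN // (subset_trans (subsetT _) (normal_norm nC)). Qed.

Lemma L3_central : K \subset 'Z([set: G]).
Proof.
suff: K \subset C by move/subset_trans; apply; apply: subsetIl.
have nCT : [set: G] \subset 'N(C) by apply: normal_norm.
rewrite lcnSn lcn2 -quotient_cents2 ?(subset_trans (subsetT _) nCT) //.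
have NZ : N / C \subset 'Z([set: G] / C).
  apply: prime_meetG; first by rewrite card_NC.
  apply: meet_center_nil; first exact/quotient_nil/(pgroup_nil pG).
    by rewrite quotient_normal ?der_normal.
  by rewrite trivg_card1 card_NC neq_ltn prime_gt1 ?orbT.
by apply: subset_trans NZ _; apply: subsetIr.
Qed.

Lemma L3_exponent c : c \in K -> c ^+ p = 1.
Proof.
move=> Kc; suff: c \in K /\ c ^+ p = 1 by case.
move: c Kc; rewrite {1}lcnSn lcn2 /commutator.
apply: gen_ind => [|g h [Kg gp] [Kh hp]|_ /imset2P[n g Nn _ ->]].
- by rewrite group1 expg1n.
- by rewrite groupM // expgMn ?gp ?hp ?mulg1 //; apply: (L3C L3_central).
have Kng := mem_L3R g Nn; split=> //.
rewrite -commXg; last exact/commute_sym/(L3C L3_central).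
apply/eqP/commgP.
have /setIP[/centerP[_ Znp] _] : n ^+ p \in C.
  have nCn : n \in 'N(C) by rewrite (subsetP (normal_norm nC)) ?inE.
  apply: coset_idr; first exact: groupX.
  by rewrite morphX // -card_NC expg_cardG // mem_quotient.
by apply: Znp; rewrite inE.
Qed.

Lemma L3_neq1 : K != 1.
Proof.
apply/eqP; rewrite lcnSn lcn2 => /commG1P cN.
have NC : N \subset C by rewrite subsetI subxx andbT subsetI subsetT.
have idx1 : #|N : C| = 1%N by apply/eqP; rewrite indexg_eq1.
by move: p_pr; rewrite -indexN idx1.
Qed.

End Converse.

Section ClassThreeIsog.
Local Open Scope group_scope.
Variables (p : nat) (G : finGroupType).
Hypotheses (p_pr : prime p) (pG : p.-group [set: G]).
Local Notation N := [set: G]^`(1).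
Local Notation K := 'L_3([set: G]).
Hypothesis KZ : K \subset 'Z([set: G]).
Hypothesis Kp : forall c, c \in K -> c ^+ p = 1.
Hypothesis K1 : K != 1.

Lemma nil_class_three : nil_class [set: G] = 3%N.
Proof.
have nilG := pgroup_nil pG; apply/eqP; rewrite eqn_leq.
apply/andP; split.
  apply/(lcn_nil_classP _ nilG); rewrite lcnSn; apply/commG1P.
  by apply: subset_trans KZ _; apply: subsetIr.
by rewrite ltnNge; apply: contra K1 => /(lcn_nil_classP _ nilG)->.
Qed.

Lemma L3_abelem : p.-abelem K.
Proof.
by apply/(abelemP p_pr); split=> //; apply: abelianS KZ (center_abelian _).
Qed.

Variables (x y : G).
Hypothesis gen_xy : <<[set x; y]>> = [set: G].
Local Notation z := [~ x, y].

Lemma der_split : exists E : {group G}, p.-abelem E /\ <[z]> \x E = N.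
Proof.
have [E KE] := abelem_split_dprod L3_abelem (subsetIr <[z]> K).
have [_ KEm cE tiE] := dprodP KE.
have sEK : E \subset K by rewrite -KEm mulG_subr.
exists E; split; first exact: abelemS sEK L3_abelem.
rewrite dprodE; first last.
- apply/trivgP; rewrite -tiE subsetI subsetIr andbT subsetI subsetIl /=.
  by apply: subset_trans sEK; apply: subsetIr.
- apply: subset_trans sEK (subset_trans KZ _); apply: subset_trans (subsetIr _ _) _.
  exact/centS/subsetT.
rewrite (der_prod gen_xy) -KEm mulgA; congr (_ * _).
by rewrite mulGSid // subsetIl.
Qed.

End ClassThreeIsog.

Lemma lrmorphism_inv (R : nzRingType) (A B : lalgType R) (f : {lrmorphism A -> B}) :
  bijective f -> exists g : {lrmorphism B -> A}, cancel f g /\ cancel g f.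
Proof.
case=> g fK gK.
have gL : linear g by apply: can2_linear fK gK.
have gM : monoid_morphism g by apply: can2_monoid_morphism fK gK.
pose g' : {lrmorphism B -> A} := HB.pack g (GRing.isLinear.Build R B A _ g gL)
  (GRing.isMonoidMorphism.Build B A g gM).
by exists g'.
Qed.

(** * Comparing two groups with isomorphic group algebras *)

Section FiniteGroups.
Local Open Scope group_scope.
Variables (p : nat) (G H : finGroupType) (A B : algType 'F_p).
Variables (eG : group_basis G A) (eH : group_basis H B).
Variables (f : {lrmorphism A -> B}) (g : {lrmorphism B -> A}).
Hypotheses (fK : cancel f g) (gK : cancel g f).
Hypotheses (p_pr : prime p) (p_odd : odd p) (pG : p.-group [set: G]).

Lemma iso_card : #|G| = #|H|.
Proof.
apply/eqP; rewrite eqn_leq (iso_leq_card p_pr eG eH fK).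
by rewrite (iso_leq_card p_pr eH eG gK).
Qed.

Lemma iso_pgroup : p.-group [set: H].
Proof. by move: pG; rewrite /pgroup !cardsT iso_card. Qed.
Let pH := iso_pgroup.

Lemma iso_card_der : #|[set: G]^`(1)| = #|[set: H]^`(1)|.
Proof.
have eqi : #|[set: G] : [set: G]^`(1)| = #|[set: H] : [set: H]^`(1)|.
  apply/eqP; rewrite eqn_leq (iso_leq_index_der p_pr eG eH fK).
  by rewrite (iso_leq_index_der p_pr eH eG gK).
have := iso_card; rewrite -!cardsT -(Lagrange (der_sub 1 [set: G])).
rewrite -(Lagrange (der_sub 1 [set: H])) eqi => /eqP.
by rewrite eqn_pmul2r ?indexg_gt0 // => /eqP.
Qed.

Lemma iso_card_center_der :
  #|'Z([set: G]) :&: [set: G]^`(1)| = #|'Z([set: H]) :&: [set: H]^`(1)|.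
Proof.
have eqi : #|'Z([set: G]) : [set: G]^`(1)| = #|'Z([set: H]) : [set: H]^`(1)|.
  apply/eqP; rewrite eqn_leq (iso_leq_index_center p_pr eG eH fK gK pH).
  by rewrite (iso_leq_index_center p_pr eH eG gK fK pG).
have eqZ : #|'Z([set: G])| = #|'Z([set: H])|.
  apply/eqP; rewrite eqn_leq (iso_leq_center p_pr eG eH fK gK pH).
  by rewrite (iso_leq_center p_pr eH eG gK fK pG).
move: eqZ; rewrite -(LagrangeI 'Z([set: G]) [set: G]^`(1)).
rewrite -(LagrangeI 'Z([set: H]) [set: H]^`(1)) eqi => /eqP.
by rewrite eqn_pmul2r ?indexg_gt0 // => /eqP.
Qed.
End FiniteGroups.

Section IndexPhi.
Local Open Scope group_scope.
Variables (p : nat) (G H : finGroupType) (A B : algType 'F_p).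
Variables (eG : group_basis G A) (eH : group_basis H B).
Variables (f : {lrmorphism A -> B}) (g : {lrmorphism B -> A}).
Hypotheses (fK : cancel f g) (gK : cancel g f).
Hypotheses (p_pr : prime p) (pG : p.-group [set: G]) (pH : p.-group [set: H]).

Lemma iso_leq_Phi_group :
  (#|[set: G] : 'Phi([set: G])| <= #|[set: H] : 'Phi([set: H])|)%N.
Proof.
apply: (iso_leq_Phi p_pr (eG := eG) (eH := eH) fK
  (M := [set: G]%G) (M' := [set: H]%G)) => // a.
  exact: iso_rel_aug.
move=> /(rel_aug2P eH) Da; apply/(rel_aug2P eG).
refine (prodS_transport (f := g) _ _ Da) => b; exact: iso_rel_aug.
Qed.

Lemma iso_leq_Phi_der :
  (#|[set: G]^`(1) : 'Phi([set: G]^`(1))| <= #|[set: H]^`(1) : 'Phi([set: H]^`(1))|)%N.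
Proof.
have pS (K : finGroupType) : p.-group [set: K] -> p.-group [set: K]^`(1).
  by move=> pK; apply: pgroupS pK; apply: subsetT.
apply: (iso_leq_Phi p_pr (eG := eG) (eH := eH) fK
  (M := [set: G]^`(1)%G) (M' := [set: H]^`(1)%G)) => // [||a|a]; try exact: pS.
  by move=> /(com_idealP eG)/(com_ideal_transport f)/(com_idealP eH).
move=> /(rel_aug2P eH) Da; apply/(rel_aug2P eG).
refine (prodS_transport (f := g) _ _ Da) => b; last by apply: iso_rel_aug.
by move=> /(com_idealP eH)/(com_ideal_transport g)/(com_idealP eG).
Qed.
End IndexPhi.

Section Main.
Local Open Scope group_scope.
Variables (p : nat) (G H : finGroupType) (A B : algType 'F_p).
Variables (eG : group_basis G A) (eH : group_basis H B).
Variables (f : {lrmorphism A -> B}) (g : {lrmorphism B -> A}).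
Hypotheses (fK : cancel f g) (gK : cancel g f).
Hypotheses (p_pr : prime p) (p_odd : odd p) (pG : p.-group [set: G]).
Local Notation NG := [set: G]^`(1).
Local Notation NH := [set: H]^`(1).
Local Notation KG := 'L_3([set: G]).
Local Notation KH := 'L_3([set: H]).
Hypotheses (KZ : KG \subset 'Z([set: G])) (Kp : forall c, c \in KG -> c ^+ p = 1).
Hypothesis K1 : KG != 1.
Variables (x y : G).
Hypothesis gen_xy : <<[set x; y]>> = [set: G].

Lemma iso_lower_central :
  nil_class [set: H] = 3 /\
  forall i, (2 <= i)%N -> 'L_i([set: G]) \isog 'L_i([set: H]).
Proof.
have pH := iso_pgroup eG eH fK gK p_pr pG.
have cardN := iso_card_der eG eH fK gK p_pr.
have indexN : #|NH : 'Z([set: H]) :&: NH| = p.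
  rewrite -(index_center_der p_pr KZ Kp K1 gen_xy) -!divgS ?subsetIr //.
  by rewrite cardN (iso_card_center_der eG eH fK gK p_pr pG).
have KHZ := L3_central p_pr pH indexN; have KHp := L3_exponent p_pr pH indexN.
have KH1 := L3_neq1 p_pr indexN.
have [u [v gen_uv]] : exists u v, <<[set u; v]>> = [set: H].
  apply: (index_Phi_two_gen p_pr pH).
  apply: leq_trans (iso_leq_Phi_group eH eG gK p_pr pH pG) _.
  exact: two_gen_index_Phi gen_xy.
set zG := [~ x, y]; set zH := [~ u, v].
have cardPhi : #|'Phi(NG)| = #|'Phi(NH)|.
  have eqi : #|NG : 'Phi(NG)| = #|NH : 'Phi(NH)|.
    apply/eqP; rewrite eqn_leq (iso_leq_Phi_der eG eH fK p_pr pG pH).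
    by rewrite (iso_leq_Phi_der eH eG gK p_pr pH pG).
  move: cardN; rewrite -(Lagrange (Phi_sub NG)) -(Lagrange (Phi_sub NH)) eqi => /eqP.
  by rewrite eqn_pmul2r ?indexg_gt0 // => /eqP.
pose q := #|'Phi(NG)|.
have oG : #[zG] = (p * q)%N by rewrite (order_gen pG KZ Kp K1 gen_xy).
have oH : #[zH] = (p * q)%N.
  by rewrite (order_gen pH KHZ KHp KH1 gen_uv) -cardPhi.
have pq_gt0 : (0 < p * q)%N by rewrite muln_gt0 prime_gt0 // cardG_gt0.
have eqcrit : (zG ^+ q \in KG) = (zH ^+ q \in KH).
  apply/idP/idP.
    move/(com_crit_iff p_pr p_odd pG KZ Kp K1 gen_xy eG oG).
    move/(com_crit_transport gK).
    by move/(com_crit_iff p_pr p_odd pH KHZ KHp KH1 gen_uv eH oH).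
  move/(com_crit_iff p_pr p_odd pH KHZ KHp KH1 gen_uv eH oH).
  move/(com_crit_transport fK).
  by move/(com_crit_iff p_pr p_odd pG KZ Kp K1 gen_xy eG oG).
have cardK : #|KG| = #|KH|.
  have cG := mul_cardG <[zG]> 'L_3([set: G]); have cH := mul_cardG <[zH]> 'L_3([set: H]).
  move: cG cH; rewrite -(der_prod gen_xy) -(der_prod gen_uv).
  rewrite (card_cap p_pr Kp oG) (card_cap p_pr KHp oH) -eqcrit -cardN => <- /eqP.
  by rewrite -!orderE oG oH (eqn_pmul2l pq_gt0) => /eqP.
have abG := L3_abelem p_pr KZ Kp; have abH := L3_abelem p_pr KHZ KHp.
split=> [|i]; first exact: nil_class_three pH KHZ KH1.
case: i => [|[|[|[|i]]]] // _.
- rewrite !lcn2.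
  have [E [abE NE]] := der_split p_pr KZ Kp gen_xy.
  have [E' [abE' NE']] := der_split p_pr KHZ KHp gen_uv.
  apply: (isog_dprod NE NE').
    by rewrite isog_cyclic_card ?cycle_cyclic // -!orderE oG oH eqxx.
  rewrite (isog_abelem_card _ abE) abE' /=.
  have := dprod_card NE; have := dprod_card NE'.
  rewrite -cardN => <- /eqP; rewrite -!orderE oG oH (eqn_pmul2l pq_gt0).
  by rewrite eq_sym.
- by rewrite (isog_abelem_card _ abG) abH cardK eqxx.
have triv (K : finGroupType) :
    'L_3([set: K]) \subset 'Z([set: K]) -> 'L_i.+4([set: K]) = 1.
  move=> KZ'; apply/trivgP; apply: subset_trans (lcn_sub_leq _ (_ : 4 <= i.+4)%N) _ => //.
  rewrite lcnSn; apply/trivgP/commG1P; apply: subset_trans KZ' _; apply: subsetIr.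
by apply: trivial_isog; apply: triv.
Qed.
End Main.

Lemma groupType_finite (H : groupType) (T : finType) (u : H -> T) (v : T -> option H) :
  pcancel u v -> exists HF : finGroupType, HF = H :> groupType.
Proof.
move=> uK; pose e := undup (pmap v (enum T)).
have eP : forall h, count_mem h e = 1.
  move=> h; rewrite count_uniq_mem ?undup_uniq // mem_undup mem_pmap.
  by rewrite -uK map_f ?mem_enum.
pose HC : countType := HB.pack H (PCanIsCountable uK).
pose HF : finGroupType := HB.pack H (PCanIsCountable uK) (isFinite.Build HC eP).
exists HF.
by case: H u v uK @e eP @HC @HF => S [m1 m2 m3 m4 m5 m6 m7 m8 m9].
Qed.

Lemma isomorphic_algebras_finite (p : nat) (G : finGroupType) (H : groupType) :
  isomorphic_algebras (group_algebra 'F_p G) (group_algebra 'F_p H) ->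
  exists HF : finGroupType, HF = H :> groupType.
Proof.
case=> f /lrmorphism_inv[g [fK gK]]; pose e := ga_basis 'F_p G.
pose u (h : H) : {ffun G -> 'F_p} := [ffun x => coef e x (g (ga_elt 1 h))].
pose v (w : {ffun G -> 'F_p}) : option H :=
  ohead (enum_fset (msupp (f (\sum_x w x *: e x)))).
apply: (groupType_finite (u := u) (v := v)) => h; rewrite /v.
have -> : \sum_x u h x *: e x = g (ga_elt 1 h).
  by rewrite [RHS](gb_sum e); apply: eq_bigr => x _; rewrite ffunE.
rewrite gK /ga_elt msuppU oner_eq0.
have : h \in enum_fset [fset h]%fset by rewrite -[_ \in _]/(h \in [fset h]%fset) inE.
have : forall k, k \in enum_fset [fset h]%fset -> k = h.
  by move=> k; rewrite -[_ \in _]/(k \in [fset h]%fset) inE => /eqP.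
by case: enum_fset => //= k s /(_ k (mem_head _ _)) ->.
Qed.

Lemma isomorphic_subgroups_ext (G H : groupType) (P : G -> Prop) (Q Q' : H -> Prop) :
  (forall h, Q h <-> Q' h) -> isomorphic_subgroups P Q -> isomorphic_subgroups P Q'.
Proof.
move=> QQ' [f [fP fM fI fS]]; exists f; split=> // [x /fP/QQ'//|z /QQ']; exact: fS.
Qed.

Theorem theorem4p1 (p : nat) (G : finGroupType) (H : groupType)
    (p_pr : prime p) (p_odd : odd p)
    (pG : (p.-group [set: G])%g)
    (isoGH : isomorphic_algebras (group_algebra 'F_p G) (group_algebra 'F_p H))
    (genG : exists x y : G, <<[set x; y]>>%g = [set: G])
    (cenG : ('L_3([set: G]) \subset 'Z([set: G]))%g)
    (expG : exponent 'L_3([set: G])%g = p) :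
  has_nilpotency_class H (nil_class [set: G]) /\
  (forall i : nat, (2 <= i)%N ->
     isomorphic_subgroups (fun x : G => x \in 'L_i([set: G])%g)
                          (lower_central H i)).
Proof.
have [HF eqH] := isomorphic_algebras_finite isoGH; case: _ / eqH isoGH => isoGH.
have [f bij_f] := isoGH; have [g [fK gK]] := lrmorphism_inv bij_f.
have [x [y gen_xy]] := genG.
have Kp c : c \in 'L_3([set: G])%g -> (c ^+ p = 1)%g.
  by move/expg_exponent; rewrite expG.
have K1 : ('L_3([set: G]) != 1)%g.
  by apply: contraTneq p_pr => K1; rewrite -expG K1 exponent1.
have [class3 isoL] := iso_lower_central (ga_basis 'F_p G) (ga_basis 'F_p HF)
  fK gK p_pr p_odd pG cenG Kp K1 gen_xy.
have pH := iso_pgroup (ga_basis 'F_p G) (ga_basis 'F_p HF) fK gK p_pr pG.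
split=> [|i /isoL isoLi].
  apply/has_nilpotency_classP; first exact: pgroup_nil pH.
  by rewrite class3 (nil_class_three pG cenG K1).
apply: (isomorphic_subgroups_ext (Q := fun h : HF => h \in 'L_i([set: HF])%g)).
  by move=> h; apply: iff_sym; apply: lower_centralP.
exact/isomorphic_subgroupsP.
Qed.
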